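(* Let $p\ge 1$ be an integer and let $\mathbf{F}_{2p}=\langle a_1,\dots,a_p,b_1,\dots,b_p\rangle$ be the free group of rank $2p$. The cyclic subgroup $C$ generated by the product of commutators $\kappa:=\prod_{i=1}^{p}[a_i,b_i]$ is a measure free-factor of $\mathbf{F}_{2p}$.
   Context: All equivalence relations are countable measured (Borel, measure preserving) equivalence relations on standard probability spaces; p.m.p. means probability measure preserving on a standard Borel probability space; ''free'' action means essentially free. For a p.m.p. action $\alpha$ of a countable group $\Gamma$ on $(X,\mu)$ and a subgroup $\Lambda<\Gamma$, $\mathcal{R}_{\alpha(\Lambda)}$ denotes the orbit equivalence relation of the restriction of $\alpha$ to $\Lambda$. An equivalence relation $\mathcal{R}$ splits as a free product $\mathcal{R}=\mathcal{R}_1\ast\mathcal{R}_2$ of two subrelations if (i) $\mathcal{R}$ is generated by $\mathcal{R}_1$ and $\mathcal{R}_2$ (it is the smallest equivalence relation containing both), and (ii) for almost every $2k$-tuple $(x_j)_{j\in\mathbb{Z}/2k\mathbb{Z}}$ ($k\ge1$) of points that are successively $\mathcal{R}_1$- and $\mathcal{R}_2$-equivalent ($x_{2i-1}\sim_{\mathcal{R}_1}x_{2i}\sim_{\mathcal{R}_2}x_{2i+1}$ for all $i$), there is some $j$ with $x_j=x_{j+1}$. A subgroup $\Lambda<\Gamma$ is a measure free-factor of $\Gamma$ if $\Gamma$ admits a free p.m.p. action $\alpha$ for which there exists a subrelation $\mathcal{S}<\mathcal{R}_{\alpha(\Gamma)}$ such that $\mathcal{R}_{\alpha(\Gamma)}=\mathcal{R}_{\alpha(\Lambda)}\ast\mathcal{S}$.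 *)

(* Defs.v *)
From HB Require Import structures.
From mathcomp Require Import all_boot all_order all_algebra.
From mathcomp Require Import all_classical all_reals all_analysis.

Set Implicit Arguments.
Unset Strict Implicit.
Unset Printing Implicit Defensive.

Local Open Scope classical_set_scope.

(* The universal property of the free group with basis [e]. *)
Definition free_basis (I : Type) (G : groupType) (e : I -> G) : Prop :=
  forall (H : groupType) (h : I -> H),
    exists! phi : G -> H,
      {morph phi : x y / (x * y)%g} /\ (forall i, phi (e i) = h i).

Definition sum_family (I J G : Type) (a : I -> G) (b : J -> G) (s : I + J) : G :=
  match s with inl i => a i | inr j => b j end.

Definition is_subgroup (G : groupType) (L : set G) : Prop :=
  L 1%g /\ (forall x y, L x -> L y -> L (x / y)%g).

Definition cyclic_subgroup (G : groupType) (x : G) : set G :=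
  [set g | exists n : nat, g = (x ^+ n)%g \/ g = (x ^- n)%g].

(* [bigop] over ['I_p] multiplies in increasing order of the index; the
   library's commutator is [~ x, y] = x^-1 y^-1 x y. *)
Definition prod_commutators (G : groupType) (p : nat) (a b : 'I_p -> G) : G :=
  (\prod_(i < p) [~ a i, b i])%g.

(* X is Borel isomorphic to a Polish space P: a Hausdorff pseudometric space is
   metric, and [f @` A] is Borel in P exactly when A is measurable in X. *)
Definition standard_borel (R : realType) d (X : measurableType d) : Prop :=
  exists (P : completePseudoMetricType R) (f : X -> P),
    [/\ hausdorff_space P, @second_countable P, bijective f &
        forall A : set X, measurable A <-> <<s @open P >> (f @` A)].

Section Actions.
Context (R : realType) d (X : measurableType d) (mu : probability X R).
Context (G : groupType) (alpha : G -> X -> X).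

Definition pmp_action : Prop :=
  [/\ forall x, alpha 1%g x = x,
      forall g h x, alpha (g * h)%g x = alpha g (alpha h x),
      forall g, measurable_fun setT (alpha g) &
      forall g (A : set X), measurable A -> mu (alpha g @^-1` A) = mu A].

Definition essentially_free : Prop :=
  {ae mu, forall x, forall g, g <> 1%g -> alpha g x <> x}.

Definition orbit_relation (L : set G) : set (X * X) :=
  [set xy | exists2 g, L g & alpha g xy.1 = xy.2].

End Actions.

Definition is_equivalence (X : Type) (E : set (X * X)) : Prop :=
  [/\ forall x, E (x, x),
      forall x y, E (x, y) -> E (y, x) &
      forall x y z, E (x, y) -> E (y, z) -> E (x, z)].

(* Countability of the classes and preservation of the measure are inherited
   from [E], so they need not be required of [S]. *)
Definition borel_subrelation d (X : measurableType d) (S E : set (X * X)) : Prop :=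
  [/\ measurable S, is_equivalence S & S `<=` E].

Section FreeProduct.
Context (R : realType) d (X : measurableType d) (mu : probability X R).

Definition alternating_cycle (E1 E2 : set (X * X)) (k : nat)
    (u : 'Z_(2 * k) -> X) : Prop :=
  forall i : 'Z_(2 * k),
    E1 (u (i *+ 2 - 1)%R, u (i *+ 2)%R) /\ E2 (u (i *+ 2)%R, u (i *+ 2 + 1)%R).

(* The cycles carry the measure obtained by integrating over mu the counting
   measure on the (countable) fibers of u |-> u 0.  A set of cycles is null for
   it if and only if almost every x has an empty fiber. *)
Definition is_free_product (E E1 E2 : set (X * X)) : Prop :=
  E = smallest (@is_equivalence X) (E1 `|` E2) /\
  (forall k : nat, (0 < k)%N ->
    {ae mu, forall x, forall u : 'Z_(2 * k) -> X,
      u 0%R = x -> alternating_cycle E1 E2 u ->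
      exists j : 'Z_(2 * k), u j = u (j + 1)%R}).

End FreeProduct.

Definition measure_free_factor (R : realType) (G : groupType) (L : set G) : Prop :=
  is_subgroup L /\
  exists (d : measure_display) (X : measurableType d) (mu : probability X R)
         (alpha : G -> X -> X),
    [/\ standard_borel R X, pmp_action mu alpha, essentially_free mu alpha &
        exists S : set (X * X),
          borel_subrelation S (orbit_relation alpha [set: G]) /\
          is_free_product mu (orbit_relation alpha [set: G])
                             (orbit_relation alpha L) S].

(* Main.v *)
Require Import Defs.
From HB Require Import structures.
From mathcomp Require Import all_boot all_order all_algebra.
From mathcomp Require Import all_classical all_reals all_analysis.
From mathcomp Require Import measurable_realfun ring lra zify.
Import Order.TTheory GRing.Theory Num.Theory.
Import numFieldNormedType.Exports.

(** Fix the last pair a, b of generators and write kappa = k' * [~ a, b].  In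
    an orbit of a free action, which is a copy of F, draw the edges from y to
    s y for every generator s; this is a tree.  For a point z the path

      y0 = (a b)^-1 z,  a^-1 z,  z,  b^-1 z,  a^-1 b^-1 z,  k' a^-1 b^-1 z = kappa y0

    becomes a closed polygon P(z) once the edge from y0 to kappa y0 is added.
    Each a-edge and each b-edge lies on exactly two polygons.  The first four
    edges of the path end, as generator edges, at a^-1 z (a b-edge), z (an
    a-edge), z (a b-edge) and b^-1 z (an a-edge).

    Given a set A of points, delete from P(z) the b-edge ending at z if z is
    in A, and the a-edge ending at b^-1 z otherwise.  The polygon on the other
    side of the deleted edge is P(T z), with T z = a z if z is in A and
    T z = b^-1 z otherwise.  Let S be the relation generated by the edges
    that remain.  Everything rests on a depth function with values in nat such
    that depth (T z) = depth z + 1; then the relation is the free product of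
    the orbits of kappa and of S.

    - Generation (generated_all).  The deleted edge of P(z) can be replaced by
      the rest of the boundary of P(z), on which the other deleted edges
      belong to polygons P(w) with T w = z, of smaller depth.  So induction on
      the depth recovers all edges from S and kappa.

    - Freeness (cut_function, cut_cycle).  For each x there is a function chi
      with values in Z/2 that is constant on the classes of S and becomes
      constant on the orbits of kappa after its value at x is flipped.  In the
      free group any Z/2 valued weight on the edges is the coboundary of a
      function (free_primitive), so it suffices to put weights on the deleted
      edges.  If f z is the weight of the deleted edge of P(z), the condition
      is that f z plus the sum of f w over T w = z is a prescribed sum of two
      Dirac masses.  It is solved by indicators of forward orbits of T, as T
      has no cycle.  In an alternating cycle, consider a shortest return to
      the same point: the function chi attached to the point after the start
      is flipped exactly once on the way, which is absurd unless the return
      takes a single step.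

    It remains to find a free action with such a depth.  It is a diagonal
    action, on the product of two spaces.

    - On the unit interval, every dyadic piece from 2^-(n+1) to 2^-n is cut
      into halves, and T translates both halves onto the next smaller piece.
      Each branch of T extends to a measure preserving bijection; since F is
      free, a can be required to act as the one and b^-1 as the other.  The
      depth is the index of the dyadic piece (depth_low, depth_high).

    - On the torus, the generators act by parabolic matrices of SL_2(Z), to
      which the ping-pong argument applies.  The fixed points of a nontrivial
      element satisfy a nontrivial linear equation with integral coefficients
      modulo 1, so almost every point has trivial stabilizer
      (fixed_point_line, rational_lines_negligible).

    Instead of the unit interval and the circle, the space carries the whole
    line with Lebesgue measure on the interval from 0 to 1; all maps are made
    periodic, so that they are bijections and the depth is defined
    everywhere.  *)

Set Implicit Arguments.
Unset Strict Implicit.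
Unset Printing Implicit Defensive.

Local Open Scope classical_set_scope.

(** * Bijections of a type, and what freeness of a group provides *)

(** The inverse is a field, so that it can be computed with; it is determined
    by the function, so equality is still extensional. *)
Record sym (T : Type) := Sym {
  sfun :> T -> T; sinv : T -> T; sfunK : cancel sfun sinv; sinvK : cancel sinv sfun }.

Lemma sym_ext T (f g : sym T) : (forall x, f x = g x) -> f = g.
Proof.
case: f g => [f f' fK f'K] [g g' gK g'K] /= /funext fg.
subst g.
have e : f' = g' by apply/funext => x; rewrite -{1}(g'K x) fK.
subst g'; by rewrite (Prop_irrelevance fK gK) (Prop_irrelevance f'K g'K).
Qed.

HB.instance Definition _ T := gen_eqMixin (sym T).
HB.instance Definition _ T := gen_choiceMixin (sym T).

Section SymGroup.
Variable T : Type.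

Definition sym_one : sym T := @Sym T id id (fun=> erefl) (fun=> erefl).
Definition sym_inv (f : sym T) : sym T := Sym (sinvK f) (sfunK f).
Definition sym_mul (f g : sym T) : sym T :=
  Sym (can_comp (sfunK f) (sfunK g)) (can_comp (sinvK g) (sinvK f)).

Lemma sym_mulA : associative sym_mul. Proof. by move=> f g h; apply: sym_ext. Qed.
Lemma sym_1mul : left_id sym_one sym_mul. Proof. by move=> f; apply: sym_ext. Qed.
Lemma sym_mul1 : right_id sym_one sym_mul. Proof. by move=> f; apply: sym_ext. Qed.
Lemma sym_mulV : left_inverse sym_one sym_inv sym_mul.
Proof. by move=> f; apply: sym_ext => x /=; rewrite sfunK. Qed.
Lemma sym_Vmul : right_inverse sym_one sym_inv sym_mul.
Proof. by move=> f; apply: sym_ext => x /=; rewrite sinvK. Qed.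

HB.instance Definition _ :=
  isGroup.Build (sym T) sym_mulA sym_1mul sym_mul1 sym_mulV sym_Vmul.

End SymGroup.

Lemma sym_mulE T (f g : sym T) x : (f * g)%g x = f (g x). Proof. by []. Qed.

Section FreeGroup.
Variables (L : Type) (F : groupType) (e : L -> F) (hF : free_basis e).
Local Open Scope group_scope.

Lemma morph1V (H : groupType) (phi : F -> H) : {morph phi : x y / x * y} ->
  phi 1 = 1 /\ (forall x, phi x^-1 = (phi x)^-1).
Proof.
move=> phiM.
have phi1 : phi 1 = 1 by apply: (mulgI (phi 1)); rewrite -phiM !mulg1.
by split=> // x; apply: (mulgI (phi x)); rewrite -phiM !mulgV.
Qed.

(** An action of a free group is a free choice of one bijection for each
    generator: the universal property is applied to the group of all
    bijections. *)
Lemma free_act T (h : L -> sym T) : exists al : F -> T -> T,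
  [/\ forall x, al 1 x = x, forall g g' x, al (g * g') x = al g (al g' x) &
      forall s x, al (e s) x = h s x].
Proof.
have [phi [[phiM phiE] _]] := hF h.
have [phi1 phiV] := morph1V phiM.
exists (fun g => sfun (phi g : sym T)); split=> [x|g g' x|s x]; first by rewrite phi1.
  by rewrite phiM.
by rewrite phiE.
Qed.

Lemma flipK (W : F -> bool) :
  involutive (fun gt : F * bool => (gt.1, gt.2 (+) W gt.1)).
Proof. by case=> g t /=; rewrite -addbA addbb addbF. Qed.

Definition flip (W : F -> bool) : sym (F * bool) := Sym (flipK W) (flipK W).

Lemma ltransK (T : Type) (g : F) :
  cancel (fun gt : F * T => (g * gt.1, gt.2)) (fun gt => (g^-1 * gt.1, gt.2)).
Proof. by case=> h t /=; rewrite mulKg. Qed.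
Lemma ltransVK (T : Type) (g : F) :
  cancel (fun gt : F * T => (g^-1 * gt.1, gt.2)) (fun gt => (g * gt.1, gt.2)).
Proof. by case=> h t /=; rewrite mulVKg. Qed.

Definition ltrans g : sym (F * bool) := Sym (@ltransK bool g) (@ltransVK bool g).

Lemma ltransM : {morph ltrans : x y / x * y}.
Proof. by move=> x y; apply: sym_ext => -[g t]; rewrite sym_mulE /= mulgA. Qed.

(** The translations by elements of F act on F * bool.  Conjugating them by
    the flip of the second component above W does not change the generators,
    since W is stable under these; by uniqueness in the universal property it
    changes no translation, so W is stable under F. *)
Lemma free_stable (W : F -> bool) : W 1 -> (forall s g, W (e s * g) = W g) ->
  forall g, W g.
Proof.
move=> W1 We g.
have [phi [_ phiU]] := hF (fun s => ltrans (e s)).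
pose psi x := flip W * ltrans x * flip W.
have flip2 : flip W * flip W = 1 by apply: sym_ext => x; rewrite sym_mulE; apply: flipK.
have E1 := phiU ltrans (conj ltransM (fun=> erefl)).
have E2 : phi = psi.
  apply: phiU; split=> [x y|s].
    rewrite /psi ltransM -!mulgA; congr (_ * (_ * _)).
    by rewrite !mulgA flip2 mul1g.
  apply: sym_ext => -[h t].
  rewrite /psi !sym_mulE /= We -addbA addbb addbF //.
have : ltrans g (1, true) = psi g (1, true) by rewrite -E1 E2.
by rewrite /psi !sym_mulE /= W1 mulg1 => -[]; case: (W g).
Qed.

Lemma free_ind (P : F -> Prop) : P 1 -> (forall s g, P g -> P (e s * g)) ->
  (forall s g, P g -> P ((e s)^-1 * g)) -> forall g, P g.
Proof.
move=> P1 PM PV g; suff: `[< P g >] by move/asboolP.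
apply: (free_stable (W := fun g => `[< P g >])) => [|s h]; first exact/asboolP.
apply: asbool_equiv_eq; split=> [/PV|/PM //].
by move=> /(_ s); rewrite mulKg.
Qed.

Lemma stepK (c : L -> F -> bool) (s : L) :
  cancel (fun gt : F * bool => (e s * gt.1, gt.2 (+) c s (e s * gt.1)))
         (fun gt => ((e s)^-1 * gt.1, gt.2 (+) c s gt.1)).
Proof. by case=> g t /=; rewrite mulKg -addbA addbb addbF. Qed.

Lemma stepVK (c : L -> F -> bool) (s : L) :
  cancel (fun gt => ((e s)^-1 * gt.1, gt.2 (+) c s gt.1))
   (fun gt : F * bool => (e s * gt.1, gt.2 (+) c s (e s * gt.1))).
Proof. by case=> g t /=; rewrite mulVKg -addbA addbb addbF. Qed.

(** The Cayley graph of a free group is a tree, so every Z/2 valued weight c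
    on its edges (c s y is the weight of the edge labelled s that ends at y) is
    a coboundary.  To see this without normal forms, let the generators act on
    F * bool by translation twisted by c, and follow the orbit of the base
    point. *)
Lemma free_primitive (c : L -> F -> bool) :
  exists chi : F -> bool, forall s g, chi (e s * g) = chi g (+) c s (e s * g).
Proof.
have [al [al1 alM alE]] := free_act (fun s => Sym (stepK c s) (stepVK c s)).
have al_1 g : forall ht, (al g ht).1 = g * ht.1.
  apply: (@free_ind (fun g => forall ht, (al g ht).1 = g * ht.1)) => [ht|s h IH ht|s h IH ht].
  - by rewrite al1 mul1g.
  - by rewrite alM alE /= IH mulgA.
  have E : al h ht = al (e s) (al ((e s)^-1 * h) ht) by rewrite -alM mulVKg.
  by rewrite -mulgA -IH E alE /= mulKg.
exists (fun g => (al g (1, false)).2) => s g.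
by rewrite alM alE /= al_1 mulg1.
Qed.

Definition letter (l : L * bool) : F := if l.2 then e l.1 else (e l.1)^-1.
Definition linv (l : L * bool) : L * bool := (l.1, ~~ l.2).

Lemma letter_inv l : letter (linv l) = (letter l)^-1.
Proof. by case: l => s [] //=; rewrite /letter /= invgK. Qed.

(** The letter records how a reduced word starts, which is what decides
    whether another letter can be prepended. *)
Inductive reduced : L * bool -> F -> Prop :=
| reduced1 l : reduced l (letter l)
| reducedS l l' g : reduced l' g -> l' <> linv l -> reduced l (letter l * g).

Lemma reducedP g : g = 1 \/ exists l, reduced l g.
Proof.
have aux l g' : g' = 1 \/ (exists l, reduced l g') ->
    letter l * g' = 1 \/ exists l', reduced l' (letter l * g').
  move=> [->|[m rm]]; first by right; exists l; rewrite mulg1; exact: reduced1.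
  have [E|ne] := pselect (m = linv l); last by right; exists l; exact: reducedS rm ne.
  case: rm E => [m' ->|m' m'' h rh _ ->]; rewrite letter_inv.
    by left; rewrite mulgV.
  by right; exists m''; rewrite mulVKg.
apply: (@free_ind (fun g => g = 1 \/ exists l, reduced l g)); first by left.
  by move=> s h; apply: (aux (s, true)).
by move=> s h; apply: (aux (s, false)).
Qed.

End FreeGroup.

(** * Cut functions *)

(** Consider a shortest return v i = v (i + d), and suppose d > 1.  Its point
    v (i + 1) is met only once on the way, so the cut function of that point
    changes at exactly one of the two adjacent steps (one of them is of type
    RC, the other of type RS) and at no other step.  It cannot return to its
    initial value. *)
Lemma cut_cycle (T : eqType) (RC RS : T -> T -> Prop)
    (cut : forall x, exists chi : T -> bool,
      (forall g h, RS g h -> chi g = chi h) /\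
      (forall g h, RC g h -> chi g (+) (g == x) = chi h (+) (h == x)))
    (v : nat -> T) (N : nat) :
    (0 < N)%N -> v N = v 0%N ->
    (forall n, if odd n then RC (v n) (v n.+1) else RS (v n) (v n.+1)) ->
  exists n, v n = v n.+1.
Proof.
move=> N0 vN st.
have exd : exists d, `[< (0 < d)%N /\ exists i, v i = v (i + d)%N >].
  by exists N; apply/asboolP; split=> //; exists 0%N; rewrite add0n vN.
case: (ex_minnP exd) => d /asboolP[d0 [i vid]] dmin.
have [d1|d1] := leqP d 1.
  by exists i; rewrite vid; congr v; lia.
(* Otherwise use the cut function of the point that follows the start. *)
have [chi [chiS chiC]] := cut (v i.+1).
have ne n : (i <= n <= i + d)%N -> n != i.+1 -> (v n == v i.+1) = false.
  move=> nid ni; apply/negP => /eqP vn.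
  have [lt|lt|E] := ltngtP n i.+1; last by rewrite E eqxx in ni.
    have /dmin : `[< (0 < i.+1 - n)%N /\ exists j, v j = v (j + (i.+1 - n))%N >].
      by apply/asboolP; split; [lia|exists n; rewrite vn; congr v; lia].
    lia.
  have /dmin : `[< (0 < n - i.+1)%N /\ exists j, v j = v (j + (n - i.+1))%N >].
    by apply/asboolP; split; [lia|exists i.+1; rewrite -vn; congr v; lia].
  lia.
have flip2 : chi (v i.+2) = ~~ chi (v i).
  have := st i; have := st i.+1; rewrite /=.
  have n0 : (v i == v i.+1) = false by apply: ne; lia.
  have n2 : (v i.+2 == v i.+1) = false by apply: ne; lia.
  case: (odd i) => /=.
    by move=> /chiS <- /chiC; rewrite n0 eqxx addbF addbT => ->; rewrite negbK.
  by move=> /chiC + /chiS ->; rewrite n2 eqxx addbF addbT => <-.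
have tel k : (i.+2 + k <= i + d)%N -> chi (v (i.+2 + k)%N) = chi (v i.+2).
  elim: k => [|k IH] kd; first by rewrite addn0.
  rewrite -IH; last lia.
  have := st (i.+2 + k)%N; rewrite addnS; case: odd => [/chiC|/chiS //].
  by rewrite !ne ?addbF//; lia.
have := tel (d - 2)%N; rewrite (_ : i.+2 + (d - 2) = i + d)%N; last lia.
rewrite -vid flip2 => /(_ (leqnn _)); by case: (chi _).
Qed.

(** The intersection form is used because membership is only ever applied to
    subgroups of elements with some desired property. *)
Definition generated_by (G : groupType) (A : set G) : set G :=
  [set g | forall W : set G, is_subgroup W -> A `<=` W -> W g].

Section Cut.
Variables (L : eqType) (F : groupType) (e : L -> F) (hF : free_basis e).
Variables (al be : L) (al_be : al != be) (k' : F).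
Hypothesis k'P : generated_by [set e s | s in [set s | s != al /\ s != be]] k'.
Local Open Scope group_scope.
Notation a := (e al).
Notation b := (e be).
Notation kappa := (k' * [~ a, b]).
Variables (A : F -> bool) (H : F -> nat).
Hypotheses (HA : forall z, A z -> H (a * z) = (H z).+1)
           (HN : forall z, ~~ A z -> H (b^-1 * z) = (H z).+1).

(** Only P(y) can delete the b-edge that ends at y, and only P(b y) can delete
    the a-edge that ends at y = b^-1 (b y). *)
Definition removed_edge (A : F -> bool) (s : L) (y : F) : bool :=
  (s == be) && A y || (s == al) && ~~ A (b * y).

Let T z := if A z then a * z else b^-1 * z.
Let O z0 y : bool := `[< exists n, iter n T z0 = y >].

Let HT z : H (T z) = (H z).+1.
Proof. by rewrite /T; case: ifPn => [/HA|/HN]. Qed.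

Let HTn n z : H (iter n T z) = (H z + n)%N.
Proof. by elim: n => [|n IH] /=; [rewrite addn0|rewrite HT IH addnS]. Qed.

(** The last two terms of the sum run over the two possible preimages of y under T.
    At most one of them lies on the forward orbit of z0, and one does exactly
    when y is on the orbit and is not its starting point; both facts hold
    because H increases along T. *)
Let orbit_coboundary z0 y :
  O z0 y (+) (A (a^-1 * y) && O z0 (a^-1 * y)) (+) (~~ A (b * y) && O z0 (b * y))
  = (y == z0).
Proof.
have pre1 : A (a^-1 * y) -> T (a^-1 * y) = y by rewrite /T => ->; rewrite mulVKg.
have pre2 : ~~ A (b * y) -> T (b * y) = y.
  by rewrite /T => /negbTE ->; rewrite mulKg.
have preO w : T w = y -> O z0 w -> (y == z0) = false.
  move=> <- /asboolP[n <-]; apply/negP => /eqP/(congr1 H).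
  by rewrite HT HTn; lia.
have Opre w : T w = y -> O z0 w -> O z0 y.
  by move=> <- /asboolP[n <-]; apply/asboolP; exists n.+1.
have Ouniq w w' : T w = y -> T w' = y -> O z0 w -> O z0 w' -> w = w'.
  move=> Tw Tw' /asboolP[n wn] /asboolP[m wm].
  have : H (T w) = H (T w') by rewrite Tw Tw'.
  rewrite !HT -wn -wm !HTn => nm; by have -> : n = m by lia.
have OS : O z0 y -> y != z0 -> exists2 w, T w = y & O z0 w.
  move=> /asboolP[[|n] /= <-]; first by rewrite eqxx.
  by move=> _; exists (iter n T z0) => //; apply/asboolP; exists n.
have [yz|yz] := eqVneq y z0.
  have -> : O z0 y by apply/asboolP; exists 0%N.
  have -> : A (a^-1 * y) && O z0 (a^-1 * y) = false.
    apply/negP => /andP[/pre1/preO h /h]; by rewrite yz eqxx.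
  have -> // : ~~ A (b * y) && O z0 (b * y) = false.
  apply/negP => /andP[/pre2/preO h /h]; by rewrite yz eqxx.
case Oy: (O z0 y); last first.
  have -> : A (a^-1 * y) && O z0 (a^-1 * y) = false.
    by apply/negP => /andP[/pre1/Opre h /h]; rewrite Oy.
  have -> // : ~~ A (b * y) && O z0 (b * y) = false.
  by apply/negP => /andP[/pre2/Opre h /h]; rewrite Oy.
have [w Tw Ow] := OS Oy yz.
case Aw: (A w).
  have Ew : w = a^-1 * y by rewrite -Tw /T Aw mulKg.
  rewrite -Ew Aw Ow /=; apply/negP => /= /andP[nA O2].
  have E := Ouniq _ _ Tw (pre2 nA) Ow O2.
  by rewrite -E Aw in nA.
have Ew : w = b * y by rewrite -Tw /T Aw mulVKg.
rewrite -Ew Aw Ow /=.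
case: (boolP (A _)) => //= A1; case: (boolP (O _ _)) => //= O1.
have E := Ouniq _ _ Tw (pre1 A1) Ow O1.
by rewrite -E Aw in A1.
Qed.

(** The sum of the weights around the polygon of z is f z plus the values of
    f at the preimages of z.  The edge of kappa on this polygon starts at
    (a b)^-1 z, so the sum has to be 1 exactly when x is one of the two ends of
    this edge, that is, at z = a b x and at z = a b kappa^-1 x; whence the choice
    of f as the sum of the indicators of the forward orbits of these two. *)
Lemma cut_function x : exists chi : F -> bool,
  (forall s g, ~~ removed_edge A s (e s * g) -> chi (e s * g) = chi g) /\
  (forall g, chi (kappa * g) (+) (kappa * g == x) = chi g (+) (g == x)).
Proof.
(* f z is the weight of the deleted edge of the polygon of z. *)
pose f z := O (a * b * x) z (+) O (a * b * kappa^-1 * x) z.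
pose c s y := if s == be then A y && f y
              else if s == al then ~~ A (b * y) && f (b * y) else false.
have [chi chiE] := free_primitive hF c.
exists chi; split=> [s g|g].
  rewrite chiE /removed_edge /c; case: eqVneq => [->|_] /=.
    by rewrite eq_sym (negbTE al_be) orbF => /negbTE ->; rewrite addbF.
  by case: eqVneq => [->|_] /=; [rewrite negbK => ->|]; rewrite addbF.
have chik' h : chi (k' * h) = chi h.
  suff : [set k | forall h, chi (k * h) = chi h] k' by apply.
  apply: k'P.
    split=> [u|k l kP lP u] /=; first by rewrite mul1g.
    by rewrite -mulgA kP -{2}(mulVKg l u) lP.
  move=> _ [s [sal sbe] <-] u /=.
  by rewrite chiE /c (negbTE sal) (negbTE sbe) addbF.
pose z := a * b * g.
have chib u : chi (b * u) = chi u (+) (A (b * u) && f (b * u)).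
  by rewrite chiE /c eqxx.
have chia u : chi (a * u) = chi u (+) (~~ A (b * a * u) && f (b * a * u)).
  by rewrite chiE /c (negbTE al_be) eqxx mulgA.
(* The two halves of the boundary of the polygon of z, from g to z and
   from a^-1 b^-1 z to z. *)
have e1 : chi z = chi g (+) (A (a^-1 * z) && f (a^-1 * z)) (+) (~~ A (b * z) && f (b * z)).
  by rewrite {1}/z -mulgA chia chib /z -!mulgA mulKg.
have e2 : chi z = chi (a^-1 * b^-1 * z) (+) f z.
  rewrite -{1}(mulVKg b z) chib mulVKg -{1}(mulVKg a (b^-1 * z)) chia.
  rewrite (_ : b * a * _ = z); last by rewrite -mulgA !mulVKg.
  by rewrite mulgA; case: (chi _); case: (A z); case: (f z).
have Ek : kappa * g = k' * (a^-1 * b^-1 * z).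
  by rewrite /z commgEl conjgE !mulgA.
rewrite Ek chik' -Ek.
have ez u : (z == a * b * u) = (g == u).
  by rewrite /z; apply/eqP/eqP => [h|-> //]; exact: mulgI h.
have e3 : f z (+) (A (a^-1 * z) && f (a^-1 * z)) (+) (~~ A (b * z) && f (b * z)) =
    (g == x) (+) (kappa * g == x).
  rewrite -(ez x) (_ : (kappa * g == x) = (z == a * b * kappa^-1 * x)).
    rewrite -!orbit_coboundary /f; do 2! case: (A _);
    by do 6! case: (O _ _).
  rewrite -(mulgA _ _ x) ez; apply/eqP/eqP => [<-|->]; last by rewrite mulVKg.
  by rewrite mulKg.
have -> : chi (a^-1 * b^-1 * z) = chi z (+) f z by rewrite e2 -addbA addbb addbF.
move: e3; rewrite e1.
by do 2! case: (A _); do 3! case: (f _); do 2! case: (_ == _); case: (chi g).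
Qed.

End Cut.

(** * Lebesgue measure on the unit interval and piecewise translations *)

Section UnitMeasure.
Local Open Scope ring_scope.
Context {R : realType}.
Notation leb := (@lebesgue_measure R).

Let measurable_unit : measurable (`]0, 1] : set (measurableTypeR R)).
Proof. exact: measurable_itv. Qed.

Definition unit_measure : set (measurableTypeR R) -> \bar R :=
  mrestr leb measurable_unit.
HB.instance Definition _ := Measure.on unit_measure.

Let unit_measure1 : unit_measure setT = 1%E.
Proof.
by rewrite /unit_measure /mrestr setTI lebesgue_measure_itv /= lte_fin ltr01 oppr0 adde0.
Qed.
HB.instance Definition _ :=
  Measure_isProbability.Build _ _ R unit_measure unit_measure1.

Lemma lebesgue_translate (c : R) (A : set R) : measurable A ->
  leb ((fun x => x + c) @^-1` A) = leb A.
Proof.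
have mc : measurable_fun setT (fun x : R => x + c) by exact: measurable_funD.
move=> mA; apply/esym.
have := lebesgue_measure_unique (mu :=
  pushforward leb ((fun x => x + c) : measurableTypeR R -> measurableTypeR R)).
move=> /(_ mc) h; apply: h => //.
move=> _ [[a b]] _ <-.
transitivity (leb (`]a - c, b - c]%classic : set R)).
  rewrite !lebesgue_measure_itv /= !lte_fin ltrD2r; case: ifP => //.
  by move=> _; rewrite -!EFinD; congr EFin; ring.
by congr leb; apply/seteqP; split=> x /=; rewrite !in_itv /= ltrBlDr lerBrDr.
Qed.

(** A bijection that is a translation on each piece of a countable partition
    carries this partition to another one, piece by piece. *)
Lemma countable_translation (I : countType) (c : I -> R) (f g : R -> R) :
  cancel f g -> cancel g f -> measurable_fun setT f ->
  (forall x, exists i, f x = x + c i) ->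
  forall A, measurable A -> leb (f @^-1` A) = leb A.
Proof.
move=> fK gK mf fc A mA.
have [i0 _] := fc 0.
pose c' n := c (odflt i0 (unpickle n)).
have fc' x : exists n, f x = x + c' n.
  by have [i ->] := fc x; exists (pickle i); rewrite /c' pickleK.
pose E := seqDU (fun n => [set x | f x = x + c' n]).
have mE n : measurable (E n).
  apply: measurableD; last apply: bigsetU_measurable => k _.
    rewrite (_ : [set _ | _] = (fun x => f x - x) @^-1` [set c' n]).
      rewrite -[X in measurable X]setTI.
      exact: (measurable_funB mf (@measurable_id _ _ _)).
    by apply/seteqP; split=> x /= => [->|<-]; ring.
  rewrite (_ : [set _ | _] = (fun x => f x - x) @^-1` [set c' k]).
    rewrite -[X in measurable X]setTI.
    exact: (measurable_funB mf (@measurable_id _ _ _)).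
  by apply/seteqP; split=> x /= => [->|<-]; ring.
have Ec n x : E n x -> f x = x + c' n by case.
have tE : trivIset setT E by apply: trivIset_seqDU.
have cE : \bigcup_n E n = setT.
  rewrite -seqDU_bigcup_eq; apply/seteqP; split=> // x _.
  by have [n xn] := fc' x; exists n.
(* G n is the image of the piece E n. *)
pose G n := (fun x => x + - c' n) @^-1` E n.
have mG n : measurable (G n).
  rewrite -[X in measurable X]setTI.
  have := @measurable_funD _ _ R setT id (cst (- c' n))
    (@measurable_id _ _ _) (@measurable_cst _ _ _ _ _ _).
  by apply.
have Gg n y : G n y -> E n (g y) /\ g y = y - c' n.
  rewrite /G /= => Ey.
  have := Ec _ _ Ey; rewrite subrK => fy.
  have -> : g y = y - c' n by rewrite -[in LHS]fy fK.
  by split.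
have tG : trivIset setT G.
  move=> i j _ _ [y [/Gg[Ei _] /Gg[Ej _]]]; apply: tE => //; by exists (g y).
have cG : \bigcup_n G n = setT.
  apply/seteqP; split=> // y _; have : (\bigcup_n E n) (g y) by rewrite cE.
  case=> n _ Eg; exists n => //; rewrite /G /=.
  by have := Ec _ _ Eg; rewrite gK => ->; rewrite addrK.
rewrite -[in LHS](setIT (f @^-1` A)) -cE setI_bigcupr.
rewrite -[in RHS](setIT A) -cG setI_bigcupr.
have mfA : measurable (f @^-1` A) by rewrite -[X in measurable X]setTI; apply: mf.
have t1 : trivIset setT (fun n => f @^-1` A `&` E n).
  by apply: trivIset_setIl.
have t2 : trivIset setT (fun n => A `&` G n) by apply: trivIset_setIl.
have m1 n : setT n -> measurable (f @^-1` A `&` E n).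
  by move=> _; apply: measurableI.
have m2 n : setT n -> measurable (A `&` G n) by move=> _; apply: measurableI.
rewrite (measure_bigcup leb setT _ m1 t1) (measure_bigcup leb setT _ m2 t2).
apply: eq_eseriesr => n _.
have mAG : measurable (A `&` G n) by apply: measurableI.
rewrite -[RHS](lebesgue_translate (c' n) mAG); congr leb.
apply/seteqP; split=> x /=.
  by move=> [Ax En]; rewrite -(Ec _ _ En); split=> //; rewrite /G /= (Ec _ _ En) addrK.
by move=> [Ax]; rewrite /G /= addrK => En; rewrite (Ec _ _ En).
Qed.

Lemma unit_measure_preserved (I : countType) (c : I -> R) (f g : R -> R) :
  cancel f g -> cancel g f -> measurable_fun setT f ->
  (forall x, Num.ceil (f x) = Num.ceil x) ->
  (forall x, exists i, f x = x + c i) ->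
  forall A, measurable A -> unit_measure (f @^-1` A) = unit_measure A.
Proof.
move=> fK gK mf fceil fc A mA.
have itvE (x : R) : (x \in `]0, 1]) = (Num.ceil x == 1).
  by rewrite (ceil_eq x 1) in_itv subrr.
rewrite /unit_measure /mrestr -[in RHS](countable_translation fK gK mf fc).
  rewrite preimage_setI; congr (leb (_ `&` _)).
  by apply/seteqP; split=> x /=; rewrite !itvE fceil.
by apply: measurableI.
Qed.

End UnitMeasure.

Section Rotation.
Local Open Scope ring_scope.
Context {R : realType}.
Implicit Types x t : R.

Definition ceilr x : R := (Num.ceil x)%:~R.

Lemma measurable_ceilr : measurable_fun setT ceilr.
Proof.
by apply: nondecreasing_measurable => // x y xy; rewrite /ceilr ler_int le_ceil.
Qed.

Lemma ceilDz x (n : int) : Num.ceil (x + n%:~R) = Num.ceil x + n.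
Proof. by rewrite ceilDrz ?intr_int // intrKceil. Qed.

(** The rotation by t of the circle, carried out inside each cell, that is,
    each interval from n - 1 (excluded) to n. *)
Definition cshift t x : R := x + t - ceilr (x + t) + ceilr x.

Lemma ceil_cshift t x : Num.ceil (cshift t x) = Num.ceil x.
Proof.
rewrite /cshift /ceilr -addrA -mulrNz -intrD ceilDz; ring.
Qed.

Lemma cshiftD s t x : cshift s (cshift t x) = cshift (s + t) x.
Proof.
rewrite {1}/cshift /ceilr ceil_cshift.
have -> : cshift t x + s = x + (s + t) + (Num.ceil x - Num.ceil (x + t))%:~R.
  by rewrite /cshift /ceilr intrB; ring.
by rewrite ceilDz /cshift /ceilr !(intrD, intrB); ring.
Qed.

Lemma cshift0 x : cshift 0 x = x.
Proof. by rewrite /cshift addr0 subrK. Qed.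

Lemma cshift_cong t x : cshift t x - (x + t) \is a Num.int.
Proof.
have -> : cshift t x - (x + t) = (Num.ceil x - Num.ceil (x + t))%:~R.
  by rewrite /cshift /ceilr intrB; ring.
exact: intr_int.
Qed.

Lemma cshiftK t : cancel (cshift t) (cshift (- t)).
Proof. by move=> x; rewrite cshiftD addNr cshift0. Qed.
Lemma cshiftNK t : cancel (cshift (- t)) (cshift t).
Proof. by move=> x; rewrite cshiftD addrN cshift0. Qed.

Lemma measurable_cshift d (T : measurableType d) (t x : T -> R) :
  measurable_fun setT t -> measurable_fun setT x ->
  measurable_fun setT (fun z => cshift (t z) (x z)).
Proof.
move=> mt mx.
have mxt : measurable_fun setT (fun z => x z + t z) by exact: measurable_funD.
apply: measurable_funD; last exact: measurableT_comp measurable_ceilr mx.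
by apply: measurable_funB => //; exact: measurableT_comp measurable_ceilr mxt.
Qed.

Lemma cshift_preserves t A : measurable A ->
  unit_measure (cshift t @^-1` A) = unit_measure A.
Proof.
apply: (@unit_measure_preserved R int (fun n => n%:~R + t) (cshift t) (cshift (- t))).
- exact: cshiftK.
- exact: cshiftNK.
- by apply: measurable_cshift.
- exact: ceil_cshift.
- by move=> x; exists (Num.ceil x - Num.ceil (x + t)); rewrite /cshift /ceilr intrB; ring.
Qed.

End Rotation.

(** * The dyadic folding map *)

Section Dyadic.
Local Open Scope ring_scope.
Context {R : realType}.
Implicit Types x t : R.

Definition dyadic (n : nat) : R := 2^-1 ^+ n.

Lemma dyadicS n : dyadic n = 2 * dyadic n.+1.
Proof. by rewrite /dyadic exprS mulrA mulfV ?mul1r. Qed.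

Lemma dyadic0 : dyadic 0 = 1. Proof. by []. Qed.
Lemma dyadic1 : dyadic 1 = 2^-1. Proof. by []. Qed.
Lemma dyadic2 : dyadic 2 = 1 / 4. Proof. by rewrite /dyadic expr2; field. Qed.

Lemma dyadic_gt0 n : 0 < dyadic n.
Proof. by rewrite exprn_gt0// invr_gt0. Qed.

Lemma dyadic_le m n : (m <= n)%N -> dyadic n <= dyadic m.
Proof. by move=> mn; apply: ler_wiXn2l => //; rewrite invf_le1 // ler1n. Qed.

Definition level t : nat :=
  if pselect (exists n, dyadic n.+1 < t) is left h then ex_minn h else 0%N.

Lemma level_eq n t : dyadic n.+1 < t <= dyadic n -> level t = n.
Proof.
move=> /andP[lt tn]; rewrite /level; case: pselect => [h|]; last by case; exists n.
case: ex_minnP => m mt /(_ _ lt) mn; apply/eqP; rewrite eqn_leq mn leqNgt.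
apply/negP => /dyadic_le h'; move: (lt_le_trans mt tn).
by rewrite ltNge h'.
Qed.

Lemma dyadic_lt t : 0 < t -> exists n, dyadic n.+1 < t.
Proof.
move=> t0; exists (Num.bound t^-1); rewrite /dyadic exprVn invf_plt ?posrE ?exprn_gt0 //.
have h : t^-1 < (Num.bound t^-1)%:R by apply: archi_boundP; rewrite invr_ge0 ltW.
apply: lt_le_trans h _; rewrite -natrX ler_nat.
by rewrite ltnW // ltnW // ltn_expl.
Qed.

Lemma levelP t : 0 < t <= 1 -> dyadic (level t).+1 < t <= dyadic (level t).
Proof.
move=> /andP[t0 t1]; rewrite /level; case: pselect => [h|[]]; last exact: dyadic_lt.
case: ex_minnP => m -> /= mmin; case: m mmin => [|m] mmin //.
by rewrite leNgt; apply/negP => /mmin; rewrite ltnn.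
Qed.

(** For t in the unit interval, the power of 2 such that t is between it
    (excluded) and twice it.  The value 0 on the left of 0 makes the function
    monotone, hence measurable. *)
Definition dyadic_below t : R := if 0 < t then dyadic (level t).+1 else 0.

Lemma dyadic_belowE t : 0 < t -> dyadic_below t = dyadic (level t).+1.
Proof. by rewrite /dyadic_below => ->. Qed.

Lemma dyadic_below_eq n t : dyadic n < t <= 2 * dyadic n -> (0 < n)%N -> dyadic_below t = dyadic n.
Proof.
case: n => // n; rewrite -dyadicS => h _; rewrite dyadic_belowE ?(level_eq h) //.
by case/andP: h => + _; apply: lt_trans; exact: dyadic_gt0.
Qed.

Lemma dyadic_belowP t : 0 < t <= 1 -> dyadic_below t < t <= 2 * dyadic_below t.
Proof. by move=> t01; rewrite dyadic_belowE; [rewrite -dyadicS; exact: levelP|case/andP: t01]. Qed.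

Definition cell_pos x : R := x - ceilr x + 1.

Lemma cell_posP x : 0 < cell_pos x <= 1.
Proof. have /andP[] := ceil_itv x; rewrite /cell_pos /ceilr intrB; lra. Qed.

Lemma measurable_cell_pos : measurable_fun setT cell_pos.
Proof.
apply: measurable_funD => //; apply: measurable_funB => //; exact: measurable_ceilr.
Qed.

Definition periodic (f : R -> R) x : R := f (cell_pos x) + (ceilr x - 1).

Lemma periodicP (f : R -> R) x : (forall t, 0 < t <= 1 -> 0 < f t <= 1) ->
  cell_pos (periodic f x) = f (cell_pos x) /\ Num.ceil (periodic f x) = Num.ceil x.
Proof.
move=> /(_ _ (cell_posP x)) fP.
have E : Num.ceil (periodic f x) = Num.ceil x.
  apply: ceil_def; rewrite /periodic intrB /ceilr; move: fP; lra.
by split=> //; rewrite /cell_pos /ceilr E /periodic /ceilr; ring.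
Qed.

Lemma periodicK (f g : R -> R) : (forall t, 0 < t <= 1 -> 0 < f t <= 1) ->
  (forall t, 0 < t <= 1 -> g (f t) = t) -> cancel (periodic f) (periodic g).
Proof.
move=> fP fK x; have [E1 E2] := periodicP x fP.
rewrite /periodic -/(periodic f x) E1 /ceilr E2 fK ?cell_posP //.
by rewrite /cell_pos /ceilr; ring.
Qed.

(** If t lies in the dyadic piece from 2 q to 4 q, its lower half is translated
    onto the next piece, from q to 2 q, and its upper half onto the same piece
    shifted by 1/2.  After a rotation by 1/2 it is the upper half that lands on
    the piece from q to 2 q. *)
Definition fold_unit t : R :=
  let q := dyadic_below t / 2 in if t <= 3 * q then t - q else t - 2 * q + 2^-1.

Definition unfold_unit t : R :=
  if t <= 2^-1 then t + dyadic_below t else (t - 2^-1) + 2 * dyadic_below (t - 2^-1).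

Lemma dyadic_below_half t q : 0 < t <= 1 -> q = dyadic_below t / 2 ->
  [/\ 0 < q, q <= 1 / 4, 2 * q < t, t <= 4 * q &
   forall s, q < s <= 2 * q -> dyadic_below s = q /\ level s = (level t).+1].
Proof.
move=> t01 qE; have /andP[lt tl] := dyadic_belowP t01.
have qE' : q = dyadic (level t).+2.
  by rewrite qE dyadic_belowE; [rewrite [dyadic _.+1]dyadicS; field|case/andP: t01].
split.
- by rewrite qE' dyadic_gt0.
- by rewrite qE' -dyadic2; exact: dyadic_le.
- by rewrite qE; lra.
- by rewrite qE; lra.
move=> s; rewrite qE' => hs; split; first exact: dyadic_below_eq.
by apply: level_eq; rewrite [X in _ <= X]dyadicS.
Qed.

Lemma dyadic_below_double s : 0 < s <= 2^-1 ->
  [/\ 0 < dyadic_below s, dyadic_below s < s, s <= 2 * dyadic_below s, 4 * dyadic_below s <= 1 &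
   forall t, 2 * dyadic_below s < t <= 4 * dyadic_below s -> dyadic_below t = 2 * dyadic_below s].
Proof.
move=> /andP[s0 s1].
have s01 : 0 < s <= 1 by rewrite s0; lra.
have /andP[lt tl] := dyadic_belowP s01.
have : (0 < level s)%N.
  rewrite lt0n; apply/eqP => l0; have := levelP s01; rewrite l0 dyadic1 dyadic0; lra.
rewrite dyadic_belowE //; case E : (level s) => [//|n] _.
have D : 2 * dyadic n.+2 = dyadic n.+1 by rewrite -dyadicS.
have d1 : dyadic n.+1 <= 2^-1 by rewrite -dyadic1; exact: dyadic_le.
have := dyadic_gt0 n.+2 => d0.
move: lt tl; rewrite dyadic_belowE // E => lt tl.
split=> //; first by lra.
move=> t ht; rewrite D; apply: dyadic_below_eq => //; lra.
Qed.

Lemma fold_unitP t : 0 < t <= 1 -> 0 < fold_unit t <= 1.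
Proof.
move=> t01; rewrite /fold_unit /=; set q := dyadic_below t / 2.
have [] := dyadic_below_half t01 (erefl q) => q0 q1 qt tq _.
case: (leP t (3 * q)); lra.
Qed.

Lemma unfold_unitP t : 0 < t <= 1 -> 0 < unfold_unit t <= 1.
Proof.
move=> /andP[t0 t1]; rewrite /unfold_unit; case: (leP t 2^-1) => h.
  by have [] := @dyadic_below_double t; lra.
by have [] := @dyadic_below_double (t - 2^-1); lra.
Qed.

Lemma fold_unitK t : 0 < t <= 1 -> unfold_unit (fold_unit t) = t.
Proof.
move=> t01; rewrite /fold_unit /=; set q := dyadic_below t / 2.
have [] := dyadic_below_half t01 (erefl q) => q0 q1 qt tq qs.
case: (leP t (3 * q)) => h; rewrite /unfold_unit.
  have -> : t - q <= 2^-1 by lra.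
  have [-> _] := qs (t - q) ltac:(lra); lra.
have -> : (t - 2 * q + 2^-1 <= 2^-1) = false by apply/negbTE; rewrite -ltNge; lra.
have [-> _] := qs (t - 2 * q + 2^-1 - 2^-1) ltac:(lra); lra.
Qed.

Lemma unfold_unitK t : 0 < t <= 1 -> fold_unit (unfold_unit t) = t.
Proof.
move=> /andP[t0 t1]; rewrite /unfold_unit; case: (leP t 2^-1) => h; rewrite /fold_unit /=.
  have [] := @dyadic_below_double t => [|d0 dt td d4 ds]; first lra.
  rewrite (ds (t + dyadic_below t)) ?ifT; lra.
have [] := @dyadic_below_double (t - 2^-1) => [|d0 dt td d4 ds]; first lra.
rewrite (ds (t - 2^-1 + 2 * dyadic_below (t - 2^-1))) ?ifF; lra.
Qed.

Definition fold_map : R -> R := periodic fold_unit.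
Definition unfold_map : R -> R := periodic unfold_unit.

Lemma fold_mapK : cancel fold_map unfold_map.
Proof. apply: periodicK; [exact: fold_unitP|exact: fold_unitK]. Qed.
Lemma unfold_mapK : cancel unfold_map fold_map.
Proof. apply: periodicK; [exact: unfold_unitP|exact: unfold_unitK]. Qed.

Definition depth x := level (cell_pos x).
Definition low x : bool := cell_pos (fold_map x) <= 2^-1.

(** With a acting as fold_map, this is the first branch of T. *)
Lemma depth_low x : low x -> depth (fold_map x) = (depth x).+1.
Proof.
rewrite /low /depth; have [-> _] := periodicP x fold_unitP.
have t01 := cell_posP x; move: (cell_pos x) t01 => t t01.
rewrite /fold_unit /=; set q := dyadic_below t / 2.
have [] := dyadic_below_half t01 (erefl q) => q0 q1 qt tq qs.
case: (leP t (3 * q)) => [h _|h h']; last by exfalso; lra.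
by have [_ ->] := qs (t - q) ltac:(lra).
Qed.

(** The second branch of T, on the upper halves of the dyadic pieces. *)
Lemma depth_high x : ~~ low x -> depth (cshift 2^-1 (fold_map x)) = (depth x).+1.
Proof.
rewrite /low /depth -ltNge => hi.
have -> : cell_pos (cshift 2^-1 (fold_map x)) = cell_pos (fold_map x) - 2^-1.
  move: hi (cell_posP (fold_map x)); move: (fold_map x) => y hi y01.
  have E : Num.ceil (y + 2^-1) = Num.ceil y + 1.
    by apply: ceil_def; move: hi y01; rewrite /cell_pos /ceilr intrB !intrD; lra.
  by rewrite /cell_pos /ceilr ceil_cshift /cshift /ceilr E intrD; lra.
move: hi; have [-> _] := periodicP x fold_unitP.
have t01 := cell_posP x; move: (cell_pos x) t01 => t t01.
rewrite /fold_unit /=; set q := dyadic_below t / 2.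
have [] := dyadic_below_half t01 (erefl q) => q0 q1 qt tq qs.
case: (leP t (3 * q)) => [h h'|h _]; first by exfalso; lra.
by have [_ ->] := qs (t - 2 * q + 2^-1 - 2^-1) ltac:(lra).
Qed.

Lemma dyadic_below_nondecreasing : nondecreasing_fun dyadic_below.
Proof.
move=> s t st; rewrite /dyadic_below; case: ifPn => s0; last first.
  by case: ifP => // _; rewrite ltW // dyadic_gt0.
rewrite (lt_le_trans s0 st); apply: dyadic_le; rewrite ltnS /level.
case: pselect => // h; case: pselect => [h'|[]]; last exact: dyadic_lt.
case: ex_minnP => m _ mmin; case: ex_minnP => n ns _.
by apply: mmin; apply: lt_le_trans st.
Qed.

Lemma measurable_dyadic_below : measurable_fun setT dyadic_below.
Proof. by apply: nondecreasing_measurable => //; exact: dyadic_below_nondecreasing. Qed.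

Lemma measurable_periodic f : measurable_fun setT f ->
  measurable_fun setT (periodic f).
Proof.
move=> mf; apply: measurable_funD; first exact: measurableT_comp mf measurable_cell_pos.
by apply: measurable_funB => //; exact: measurable_ceilr.
Qed.

Lemma measurable_fold_map : measurable_fun setT fold_map.
Proof.
apply: measurable_periodic; rewrite /fold_unit.
have mq : measurable_fun setT (fun t => dyadic_below t / 2).
  by apply: measurable_funM => //; exact: measurable_dyadic_below.
apply: measurable_fun_ifT.
- by apply: measurable_fun_ler => //; apply: measurable_funM.
- exact: measurable_funB.
- by apply: measurable_funD => //; apply: measurable_funB => //; apply: measurable_funM.
Qed.

Lemma measurable_unfold_map : measurable_fun setT unfold_map.
Proof.
apply: measurable_periodic; rewrite /unfold_unit.
have m2 : measurable_fun setT (fun t : R => t - 2^-1) by apply: measurable_funB.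
apply: measurable_fun_ifT.
- exact: measurable_fun_ler.
- by apply: measurable_funD => //; exact: measurable_dyadic_below.
- apply: measurable_funD => //; apply: measurable_funM => //.
  exact: measurableT_comp measurable_dyadic_below m2.
Qed.

Lemma measurable_low : measurable_fun setT low.
Proof.
apply: measurable_fun_ler => //.
exact: measurableT_comp measurable_cell_pos measurable_fold_map.
Qed.

Lemma periodic_shift f (c : R) x : f (cell_pos x) = cell_pos x + c -> periodic f x = x + c.
Proof. by rewrite /periodic => ->; rewrite /cell_pos; ring. Qed.

Lemma fold_map_preserves A : measurable A ->
  unit_measure (fold_map @^-1` A) = unit_measure A.
Proof.
apply: (@unit_measure_preserved R (bool * nat)%type
  (fun i => if i.1 then - (dyadic i.2.+1 / 2) else - dyadic i.2.+1 + 2^-1) fold_map unfold_map).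
- exact: fold_mapK.
- exact: unfold_mapK.
- exact: measurable_fold_map.
- by move=> x; have [] := periodicP x fold_unitP.
move=> x; have /andP[t0 _] := cell_posP x.
exists (cell_pos x <= 3 * (dyadic_below (cell_pos x) / 2), level (cell_pos x)).
apply: periodic_shift; rewrite /fold_unit /=.
by case: ifP => _; rewrite dyadic_belowE //; field.
Qed.

Lemma unfold_map_preserves A : measurable A ->
  unit_measure (unfold_map @^-1` A) = unit_measure A.
Proof.
move=> mA; have mu : measurable (unfold_map @^-1` A).
  by rewrite -[X in measurable X]setTI; apply: measurable_unfold_map.
rewrite -(fold_map_preserves mu); congr unit_measure.
by apply/seteqP; split=> x /=; rewrite fold_mapK.
Qed.

End Dyadic.

(** * Shears of the torus *)

Definition mpreserving (R : realType) d (T : measurableType d)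
    (mu : set T -> \bar R) (f : T -> T) : Prop :=
  measurable_fun setT f /\ forall A, measurable A -> mu (f @^-1` A) = mu A.

Lemma mpreserving_comp (R : realType) d (T : measurableType d)
    (mu : set T -> \bar R) (f g : T -> T) :
  mpreserving mu f -> mpreserving mu g -> mpreserving mu (f \o g).
Proof.
move=> [mf pf] [mg pg]; split; first exact: measurableT_comp.
move=> A mA; rewrite comp_preimage pg ?pf //.
by rewrite -[X in measurable X]setTI; apply: mf.
Qed.

Section Product.
Context {R : realType} d1 d2 (T1 : measurableType d1) (T2 : measurableType d2).
Variables (P1 : probability T1 R) (P2 : probability T2 R).

(** This allows one to integrate in the order in which the fibers of a given
    map come. *)
Lemma product_measureC A : measurable A -> (P1 \x P2)%E A = (P1 \x^ P2)%E A.
Proof.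
move=> mA; apply: product_measure_unique => // B C mB mC.
exact: product_measure2E.
Qed.

(** By Fubini, a map that preserves each fiber and its measure preserves the
    product measure. *)
Lemma mpreserving_fiber2 (f : T1 -> T2 -> T2) :
  measurable_fun setT (fun z => f z.1 z.2) -> (forall x, mpreserving P2 (f x)) ->
  mpreserving (P1 \x P2)%E (fun z => (z.1, f z.1 z.2)).
Proof.
move=> mf pf; split; first exact: (measurable_fun_pair measurable_fst mf).
move=> A mA; apply: eq_integral => x _ /=.
have [_ /(_ _ (measurable_xsection x mA)) <-] := pf x.
by congr (P2 _); apply/seteqP; split=> y /=; rewrite /xsection /= !inE.
Qed.

Lemma mpreserving_fiber1 (f : T2 -> T1 -> T1) :
  measurable_fun setT (fun z => f z.2 z.1) -> (forall x, mpreserving P1 (f x)) ->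
  mpreserving (P1 \x P2)%E (fun z => (f z.2 z.1, z.2)).
Proof.
move=> mf pf.
have mF : measurable_fun setT (fun z : T1 * T2 => (f z.2 z.1, z.2)).
  exact: (measurable_fun_pair mf measurable_snd).
split=> // A mA.
have mFA : measurable ((fun z : T1 * T2 => (f z.2 z.1, z.2)) @^-1` A).
  by rewrite -[X in measurable X]setTI; apply: mF.
rewrite !product_measureC //; apply: eq_integral => y _ /=.
have [_ /(_ _ (measurable_ysection y mA)) <-] := pf y.
by congr (P1 _); apply/seteqP; split=> x /=; rewrite /ysection /= !inE.
Qed.

Lemma mpreserving_prod (f : T1 -> T1) (g : T2 -> T2) :
  mpreserving P1 f -> mpreserving P2 g ->
  mpreserving (P1 \x P2)%E (fun z => (f z.1, g z.2)).
Proof.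
move=> pf pg.
have p1 := @mpreserving_fiber1 (fun=> f) (measurableT_comp pf.1 measurable_fst) (fun=> pf).
have p2 := @mpreserving_fiber2 (fun=> g) (measurableT_comp pg.1 measurable_snd) (fun=> pg).
exact: mpreserving_comp p1 p2.
Qed.

End Product.

Section Torus.
Local Open Scope ring_scope.
Context {R : realType}.
Notation I := (measurableTypeR R).
Notation unit_mu := (@unit_measure R).
Implicit Types (m : R) (k c : int) (z : I * I).

Definition shear1 m z : I * I := (cshift (m * z.2) z.1, z.2).
Definition shear2 m z : I * I := (z.1, cshift (m * z.1) z.2).

Lemma shear1K m : cancel (shear1 m) (shear1 (- m)).
Proof. by case=> x y; rewrite /shear1 /= mulNr cshiftK. Qed.
Lemma shear1VK m : cancel (shear1 (- m)) (shear1 m).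
Proof. by case=> x y; rewrite /shear1 /= mulNr cshiftNK. Qed.
Lemma shear2K m : cancel (shear2 m) (shear2 (- m)).
Proof. by case=> x y; rewrite /shear2 /= mulNr cshiftK. Qed.

Lemma cshift_mpreserving (t : R) : mpreserving unit_mu (cshift t).
Proof. by split; [exact: measurable_cshift|exact: cshift_preserves]. Qed.

Lemma shear1_mpreserving m : mpreserving (unit_mu \x unit_mu)%E (shear1 m).
Proof.
apply: (@mpreserving_fiber1 R _ _ I I unit_mu unit_mu (fun y => cshift (m * y))).
  apply: measurable_cshift; last exact: measurable_fst.
  by apply: measurable_funM => //; exact: measurable_snd.
by move=> y; exact: cshift_mpreserving.
Qed.

Lemma shear2_mpreserving m : mpreserving (unit_mu \x unit_mu)%E (shear2 m).
Proof.
apply: (@mpreserving_fiber2 R _ _ I I unit_mu unit_mu (fun y => cshift (m * y))).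
  apply: measurable_cshift; last exact: measurable_snd.
  by apply: measurable_funM => //; exact: measurable_fst.
by move=> y; exact: cshift_mpreserving.
Qed.

(** Modulo 1, the parabolic matrix with parameter c that fixes the direction
    (2 k, 1).  As a product of elementary shears it visibly preserves the
    measure. *)
Definition parabolic (k c : int) z : I * I :=
  shear1 (2 * k)%:~R (shear2 c%:~R (shear1 (- (2 * k)%:~R) z)).

Lemma parabolicK k c : cancel (parabolic k c) (parabolic k (- c)).
Proof.
by move=> z; rewrite /parabolic shear1K mulrNz shear2K shear1VK.
Qed.

Lemma parabolicVK k c : cancel (parabolic k (- c)) (parabolic k c).
Proof. by move=> z; have := parabolicK k (- c) z; rewrite opprK. Qed.

Lemma parabolic_mpreserving k c :
  mpreserving (unit_mu \x unit_mu)%E (parabolic k c).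
Proof.
apply: (@mpreserving_comp _ _ _ _ (shear1 (2 * k)%:~R)
  (fun z => shear2 c%:~R (shear1 (- (2 * k)%:~R) z))).
  exact: shear1_mpreserving.
apply: (@mpreserving_comp _ _ _ _ (shear2 _) (shear1 _)).
  exact: shear2_mpreserving.
exact: shear1_mpreserving.
Qed.

(** Modulo 1, f is the linear map with rows (p, q) and (r, s). *)
Definition linear_mod1 (f : I * I -> I * I) (p q r s : int) : Prop := forall z,
  ((f z).1 - (p%:~R * z.1 + q%:~R * z.2) : R) \is a Num.int /\
  ((f z).2 - (r%:~R * z.1 + s%:~R * z.2) : R) \is a Num.int.

Lemma linear_mod1_comp f p q r s f' p' q' r' s' :
  linear_mod1 f p q r s -> linear_mod1 f' p' q' r' s' ->
  linear_mod1 (f \o f') (p * p' + q * r') (p * q' + q * s')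
                        (r * p' + s * r') (r * q' + s * s').
Proof.
move=> Hf Hf' z; have [f1 f2] := Hf (f' z); have [f'1 f'2] := Hf' z.
have aux (i j : int) (A B C x y : R) :
    A - ((i * p' + j * r')%:~R * x + (i * q' + j * s')%:~R * y) =
    (A - (i%:~R * B + j%:~R * C)) + i%:~R * (B - (p'%:~R * x + q'%:~R * y))
      + j%:~R * (C - (r'%:~R * x + s'%:~R * y)).
  by rewrite !(intrD, intrM); ring.
have aux2 (i j : int) (a b c : R) : a \is a Num.int -> b \is a Num.int ->
    c \is a Num.int -> a + i%:~R * b + j%:~R * c \is a Num.int.
  by move=> ai bi ci; rewrite !(rpredD, rpredM) ?intr_int.
by split; rewrite /= (aux _ _ _ (f' z).1 (f' z).2); apply: aux2.
Qed.

Lemma shear1_linear (m : int) : linear_mod1 (shear1 m%:~R) 1 m 0 1.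
Proof.
move=> z /=; split; last by rewrite mul0r add0r mul1r subrr rpred0.
by rewrite mul1r; exact: cshift_cong.
Qed.

Lemma shear2_linear (m : int) : linear_mod1 (shear2 m%:~R) 1 0 m 1.
Proof.
move=> z /=; split; first by rewrite mul0r addr0 mul1r subrr rpred0.
by rewrite mul1r [X in _ - X]addrC; exact: cshift_cong.
Qed.

Lemma parabolic_linear k c :
  linear_mod1 (parabolic k c) (1 + 2 * k * c) (- (4 * k ^+ 2 * c)) c (1 - 2 * k * c).
Proof.
have := linear_mod1_comp (shear1_linear (2 * k))
  (linear_mod1_comp (shear2_linear c) (shear1_linear (- (2 * k)))).
rewrite mulrNz; congr linear_mod1; ring.
Qed.

(** The determinant q of a vector with the fixed direction does not change
    under its parabolic map, while r moves by c q.  As 3 is large enough, a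
    vector that is outside the cone q^2 < r^2, or inside it on the side towards
    which it is moved, ends up inside it on that side. *)
Lemma ping_pong_in (c q r : int) : c = 3 \/ c = -3 ->
  r ^+ 2 < q ^+ 2 \/ 0 < c * q * r ->
  0 < c * q * (r + c * q) /\ q ^+ 2 < (r + c * q) ^+ 2.
Proof. by case=> -> [] h; split; nia. Qed.

(** The cones around two fixed directions are disjoint when their integral
    parameters differ; m is the difference of the parameters. *)
Lemma ping_pong_out (u r m : int) : u ^+ 2 < r ^+ 2 -> m != 0 ->
  r ^+ 2 < (u + 2 * m * r) ^+ 2.
Proof.
move=> ur m0.
have sqr_lt (x y : int) : (x ^+ 2 < y ^+ 2) = (`|x| < `|y|).
  by rewrite -[RHS](@ltr_pXn2r _ 2%N) ?nnegrE // !real_normK ?num_real.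
move: ur; rewrite !sqr_lt => ur.
have m1 : 1 <= `|m| by lia.
have : 2 * `|r| <= `|2 * m * r| by rewrite !normrM; nia.
have := lerB_normD (2 * m * r) u; rewrite [u + _]addrC; lia.
Qed.

Section PingPong.
Variables (L : Type) (F : groupType) (e : L -> F) (hF : free_basis e).
Variables (k : L -> int) (k_inj : injective k).
Variable (al : F -> I * I -> I * I).
Hypotheses (al1 : forall z, al 1%g z = z)
  (alM : forall g h z, al (g * h)%g z = al g (al h z))
  (alE : forall s z, al (e s) z = parabolic (k s) 3 z).

Definition slope (b : bool) : int := if b then 3 else -3.

Lemma al_letter l z : al (letter e l) z = parabolic (k l.1) (slope l.2) z.
Proof.
case: l => s [] /=; rewrite /letter /= ?alE //.
by rewrite -[in RHS](al1 z) -(mulgV (e s)) alM alE parabolicK.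
Qed.

(** The cone into which a letter moves vectors: the one around its fixed
    direction, split in two by the sign that tells a generator from its
    inverse. *)
Definition attracted (l : L * bool) (p r : int) : Prop :=
  let q := p - 2 * k l.1 * r in 0 < slope l.2 * q * r /\ q ^+ 2 < r ^+ 2.

Lemma ping_pong l p r :
  (let q := p - 2 * k l.1 * r in r ^+ 2 < q ^+ 2 \/ 0 < slope l.2 * q * r) ->
  attracted l ((1 + 2 * k l.1 * slope l.2) * p - 4 * k l.1 ^+ 2 * slope l.2 * r)
     (slope l.2 * p + (1 - 2 * k l.1 * slope l.2) * r).
Proof.
rewrite /attracted /=; set q := p - _; set c := slope _; set j := k _ => h.
have -> : c * p + (1 - 2 * j * c) * r = r + c * q by rewrite /q; ring.
have -> : (1 + 2 * j * c) * p - 4 * j ^+ 2 * c * r - 2 * j * (r + c * q) = q.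
  by rewrite /q; ring.
by apply: ping_pong_in h; rewrite /c /slope; case: l.2; [left|right].
Qed.

Lemma attracted_out l l' p r : l' <> linv l -> attracted l' p r ->
  let q := p - 2 * k l.1 * r in r ^+ 2 < q ^+ 2 \/ 0 < slope l.2 * q * r.
Proof.
move=> ne [a1 a2] q.
have [E|nE] := pselect (l'.1 = l.1).
  right; move: a1; rewrite /q -E.
  suff -> : l'.2 = l.2 by [].
  move: ne E; case: l l' {q a2} => [s b] [s' b'] /= ne E.
  by move: ne; rewrite E /linv /=; case: b; case: b' => //= h; case: h.
left.
have n0 : k l'.1 - k l.1 != 0 by rewrite subr_eq0; apply/eqP => /k_inj.
have -> : q = (p - 2 * k l'.1 * r) + 2 * (k l'.1 - k l.1) * r by rewrite /q; ring.
exact: ping_pong_out.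
Qed.

(** Ping-pong started at the vector (1, 0), which is outside all cones; (p, r)
    is its image. *)
Lemma reduced_attracted l g : reduced e l g -> exists p q r s,
  linear_mod1 (al g) p q r s /\ attracted l p r.
Proof.
have al_lin l' : linear_mod1 (al (letter e l')) (1 + 2 * k l'.1 * slope l'.2)
    (- (4 * k l'.1 ^+ 2 * slope l'.2)) (slope l'.2) (1 - 2 * k l'.1 * slope l'.2).
  rewrite (_ : al _ = parabolic (k l'.1) (slope l'.2)); first exact: parabolic_linear.
  by apply/funext => z; exact: al_letter.
elim=> {l g} [l|l l' g rg [p [q [r [s [lin att]]]]] ne].
  do 4! eexists; split; first exact: al_lin.
  have := @ping_pong l 1 0; rewrite !mulr0 !mulr1 !(subr0, addr0).
  by apply; left; rewrite /= expr0n expr1n.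
do 4! eexists; split.
  rewrite (_ : al _ = al (letter e l) \o al g); last by apply/funext => z; exact: alM.
  apply: linear_mod1_comp; [exact: al_lin|exact: lin].
rewrite mulNr; apply: ping_pong; exact: attracted_out ne att.
Qed.

(** The second row of the matrix of g differs from (0, 1), as the image
    (p, r) of (1, 0) lies in a cone, where r is not zero; so it gives a
    nontrivial equation for fixed points. *)
Lemma fixed_point_line g : g <> 1%g -> exists r s : int, r != 0 /\
  forall z, al g z = z -> (r%:~R * z.1 + s%:~R * z.2 : R) \is a Num.int.
Proof.
move=> g1; have [//|[l /reduced_attracted[p [q [r [s [lin [a1 a2]]]]]]]] := reducedP hF g.
exists r, (s - 1); split.
  by apply/eqP => r0; move: a1; rewrite r0 mulr0 ltxx.
move=> z gz; have [_] := lin z; rewrite gz => h.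
have aux (x y : R) : r%:~R * x + (s - 1)%:~R * y = - (y - (r%:~R * x + s%:~R * y)).
  by rewrite intrB; ring.
by rewrite aux rpredN.
Qed.

End PingPong.

Definition rational_lines : set (I * I) :=
  [set z | exists r s n : int, r != 0 /\ (r%:~R * z.1 + s%:~R * z.2 : R) = n%:~R].

Lemma rational_lines_negligible : (unit_mu \x unit_mu)%E.-negligible rational_lines.
Proof.
pose line (t : int * int * int) : set (I * I) :=
  [set z | t.1.1 != 0 /\ (t.1.1%:~R * z.1 + t.1.2%:~R * z.2 : R) = t.2%:~R].
suff nl t : (unit_mu \x unit_mu)%E.-negligible (line t).
  apply: (@negligibleS _ _ _ _ (\bigcup_n if unpickle n is Some t then line t else set0)).
    move=> z [r [s [n [r0 E]]]].
    have : line (r, s, n) z by split.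
    by move: (r, s, n) => t lz; exists (pickle t); [exact: Logic.I|rewrite pickleK].
  apply: negligible_bigcup => n; case: unpickle => [t|]; first exact: nl.
  exact: negligible_set0.
case: t => [[r s] n]; have [->|r0] := eqVneq r 0.
  have -> : line (0, s, n) = set0 by apply/seteqP; split=> z //= [].
  exact: negligible_set0.
have mline : measurable (line (r, s, n)).
  have mf : measurable_fun setT (fun z : I * I => (r%:~R * z.1 + s%:~R * z.2 : R)).
    apply: measurable_funD; apply: measurable_funM => //.
  have := mf measurableT [set n%:~R] (measurable_set1 _); rewrite setTI.
  by congr measurable; apply/seteqP; split=> z /= => [|[]//]; split.
exists (line (r, s, n)); split=> //.
rewrite product_measureC //; apply: integral0_eq => y _ /=.
apply/eqP; rewrite -measure_le0.
have msec : measurable (ysection (line (r, s, n)) y) by exact: measurable_ysection.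
rewrite /unit_measure /mrestr.
apply: (@le_trans _ _ (@lebesgue_measure R [set (n%:~R - s%:~R * y) / r%:~R])).
  apply: le_measure; rewrite ?inE //; first exact: measurableI.
  move=> x [+ _]; rewrite /ysection /= inE => -[_ /= E].
  by rewrite -E addrK mulrAC mulfV ?mul1r // intr_eq0.
by rewrite lebesgue_measure_set1.
Qed.

End Torus.

(** * Products of standard Borel spaces *)

HB.instance Definition _ (T U : completeType) := Pointed.on (T * U)%type.

Lemma prod_complete (T U : completeType) (F : set_system (T * U)) :
  ProperFilter F -> cauchy F -> cvg F.
Proof.
move=> FF Fc.
have c1 : cauchy (fst @ F).
  move=> A entA.
  have /Fc[[P Q] /= [FP FQ] PQ] : entourage [set xy : (T * U) * (T * U) | A (xy.1.1, xy.2.1)].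
    exists (A, setT); first by split=> //; exact: entourageT.
    by move=> -[[x1 x2] [y1 y2]] [/= Ax _]; exists ((x1, y1), (x2, y2)).
  exists (fst @` P, fst @` Q); first split=> /=.
  - by apply: filterS FP => x Px; exists x.
  - by apply: filterS FQ => x Px; exists x.
  by move=> -[x y] [/= [x' Px <-] [y' Qy <-]]; exact: (PQ (x', y') (conj Px Qy)).
have c2 : cauchy (snd @ F).
  move=> A entA.
  have /Fc[[P Q] /= [FP FQ] PQ] : entourage [set xy : (T * U) * (T * U) | A (xy.1.2, xy.2.2)].
    exists (setT, A); first by split=> //; exact: entourageT.
    by move=> -[[x1 x2] [y1 y2]] [/= _ Ax]; exists ((x1, y1), (x2, y2)).
  exists (snd @` P, snd @` Q); first split=> /=.
  - by apply: filterS FP => x Px; exists x.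
  - by apply: filterS FQ => x Px; exists x.
  by move=> -[x y] [/= [x' Px <-] [y' Qy <-]]; exact: (PQ (x', y') (conj Px Qy)).
have /cvg_ex[l1 h1] : cvg (fst @ F) by apply: cauchy_cvg.
have /cvg_ex[l2 h2] : cvg (snd @ F) by apply: cauchy_cvg.
apply/cvg_ex; exists (l1, l2) => A [[P Q] /= [/h1 P1 /h2 Q1] PQ].
have FP : F (fst @^-1` P) by [].
have FQ : F (snd @^-1` Q) by [].
by apply: filterS (filterI FP FQ) => -[x y] [Px Qy]; exact: (PQ (x, y) (conj Px Qy)).
Qed.

HB.instance Definition _ (T U : completeType) :=
  Uniform_isComplete.Build (T * U)%type (@prod_complete T U).
HB.instance Definition _ (R : numDomainType) (T U : completePseudoMetricType R) :=
  Uniform_isComplete.Build (T * U)%type (@prod_complete T U).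

Lemma countable_prod_basis (T U : Type) (B : set (set T)) (C : set (set U)) :
  countable B -> countable C -> countable [set b.1 `*` b.2 | b in B `*` C].
Proof.
by move=> cB cC; apply: sub_countable (countableX cB cC); exact: card_image_le.
Qed.

Lemma basis_prod (T U : topologicalType) (B : set (set T)) (C : set (set U)) :
  basis B -> basis C -> basis [set b.1 `*` b.2 | b in B `*` C].
Proof.
move=> [Bo Bb] [Co Cb].
split=> [_ [[b c] /= [/Bo bo /Co co] <-]|].
  rewrite openE => -[x y] [/= bx cy]; exists (b, c) => //.
  by split; apply: open_nbhs_nbhs.
move=> [x y] A [[P Q] /= [/Bb[b [Bb1 bx] bP] /Cb[c [Cc cy] cQ]] PQ].
exists (b `*` c); first by split=> //; exists (b, c).
by move=> z [/bP ? /cQ ?]; apply: PQ.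
Qed.

Lemma hausdorff_prod (T U : topologicalType) :
  hausdorff_space T -> hausdorff_space U -> hausdorff_space (T * U)%type.
Proof.
move=> hT hU [x1 x2] [y1 y2] clxy; congr pair.
  apply: hT => A B nA nB.
  have [|| [z1 z2] [/= zA zB]] := clxy (A `*` setT) (B `*` setT).
  - by exists (A, setT) => //; split=> //=; exact: filterT.
  - by exists (B, setT) => //; split=> //=; exact: filterT.
  by exists z1; split; [case: zA|case: zB].
apply: hU => A B nA nB.
have [|| [z1 z2] [/= zA zB]] := clxy (setT `*` A) (setT `*` B).
- by exists (setT, A) => //; split=> //=; exact: filterT.
- by exists (setT, B) => //; split=> //=; exact: filterT.
by exists z2; split; [case: zA|case: zB].
Qed.

Lemma open_countable_basis (T : topologicalType) (B : set (set T)) (O : set T) :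
  basis B -> open O -> O = \bigcup_(b in [set b | B b /\ b `<=` O]) b.
Proof.
move=> [Bo Bb] oO; apply/seteqP; split=> x.
  move=> Ox; have /Bb[b [? ?] ?] : nbhs x O by exact: open_nbhs_nbhs.
  by exists b.
by case=> b [_ h] /h.
Qed.

Lemma second_countable_realType (R : realType) : @second_countable R.
Proof.
exists [set (`]ratr pq.1, ratr pq.2[%classic : set R) | pq in [set: rat * rat]].
  by apply: sub_countable (card_image_le _ _) _; exact: countableP.
split=> [_ [pq _ <-]|x A].
  exact: interval_open.
rewrite -nbhs_ballE => -[e /= e0 eA].
have /rat_in_itvoo[p] : (x - e < x)%R by lra.
have /rat_in_itvoo[q] : (x < x + e)%R by lra.
rewrite !in_itv /= => /andP[xq qe] /andP[ep px].
exists (`]ratr p, ratr q[%classic) => /=.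
  by split; [exists (p, q)|rewrite /= in_itv /= px].
move=> y; rewrite /= in_itv /= => /andP[py yq].
by apply: eA; rewrite /ball /= ltr_distlC; lra.
Qed.

(** Open sets of a product are unions of rectangles from a countable basis,
    of which this takes the inverse image. *)
Lemma countable_bigcup_measurable d (T : measurableType d) (V : Type)
    (D : set (set V)) (h : set V -> set T) :
  countable D -> (forall b, D b -> measurable (h b)) ->
  measurable (\bigcup_(b in D) h b).
Proof.
move=> cD mh.
have [->|/set0P[b0 Db0]] := eqVneq D set0; first by rewrite bigcup_set0.
have /pfcard_geP[D0|[f]] := cD; first by move: Db0; rewrite D0.
have -> : \bigcup_(b in D) h b = \bigcup_n h (f n).
  apply/seteqP; split=> x [b ].
    by move=> /(surj (f := f))[n _ <-] fx; exists n.
  by move=> _ fx; exists (f b) => //; exact: funS.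
by apply: bigcupT_measurable => n; apply: mh; exact: funS.
Qed.

Lemma standard_borel_real (R : realType) : standard_borel R (measurableTypeR R).
Proof.
exists R, id; split; [exact: Rhausdorff|exact: second_countable_realType|by exists id|].
move=> A; rewrite image_id; split=> h.
  have : (@RGenOpens.G R).-sigma.-measurable A by rewrite -RGenOpens.measurableE.
  apply: smallest_sub; first exact: smallest_sigma_algebra.
  by move=> _ [x [y ->]]; apply: sub_sigma_algebra; exact: interval_open.
move: A h; apply: smallest_sub.
  exact: sigma_algebra_measurable.
by move=> A; exact: open_measurable.
Qed.

(** The Borel sets of the product of two second countable spaces are
    generated by rectangles, which identifies them with the measurable sets
    of the product. *)
Lemma standard_borel_prod (R : realType) d1 d2 (X : measurableType d1)
    (Y : measurableType d2) :
  standard_borel R X -> standard_borel R Y -> standard_borel R (X * Y)%type.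
Proof.
move=> [P [f [hP [B cB bB] [f' fK f'K] mf]]] [Q [g [hQ [C cC bC] [g' gK g'K] mg]]].
exists (P * Q)%type, (fun z => (f z.1, g z.2)); split.
- exact: hausdorff_prod.
- exists [set b.1 `*` b.2 | b in B `*` C]; [exact: countable_prod_basis|exact: basis_prod].
- by exists (fun z => (f' z.1, g' z.2)) => -[x y] /=; rewrite ?fK ?gK ?f'K ?g'K.
have imE (T U : Type) (h : T -> U) h' (hK : cancel h h') (h'K : cancel h' h) A :
    h @` A = h' @^-1` A.
  apply/seteqP; split=> x /=; first by case=> y Ay <-; rewrite hK.
  by move=> Ax; exists (h' x).
have FK : cancel (fun z => (f z.1, g z.2)) (fun z => (f' z.1, g' z.2)).
  by case=> x y /=; rewrite fK gK.
have F'K : cancel (fun z => (f' z.1, g' z.2)) (fun z => (f z.1, g z.2)).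
  by case=> x y /=; rewrite f'K g'K.
move=> A; rewrite (imE _ _ _ _ FK F'K); split.
  pose Z := g_sigma_algebraType (@open (P * Q)%type).
  have m1 : measurable_fun setT (fun z : Z => f' z.1).
    move=> _ D /mf; rewrite setTI (imE _ _ _ _ fK f'K) => mD.
    suff : <<s @open P >> `<=` [set E | <<s @open (P * Q)%type >> (fst @^-1` E)].
      by move=> h; exact: h mD.
    apply: smallest_sub; last first.
      by move=> O oO; apply: sub_sigma_algebra; apply: open_comp oO => z _; exact: cvg_fst.
    split=> /=.
    + by rewrite preimage_set0; exact: (measurable0 (s := Z)).
    + move=> E mE; rewrite setTD preimage_setC; exact: (@measurableC _ Z).
    + move=> E mE; rewrite preimage_bigcup; exact: (@bigcupT_measurable _ Z).
  have m2 : measurable_fun setT (fun z : Z => g' z.2).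
    move=> _ D /mg; rewrite setTI (imE _ _ _ _ gK g'K) => mD.
    suff : <<s @open Q >> `<=` [set E | <<s @open (P * Q)%type >> (snd @^-1` E)].
      by move=> h; exact: h mD.
    apply: smallest_sub; last first.
      by move=> O oO; apply: sub_sigma_algebra; apply: open_comp oO => z _; exact: cvg_snd.
    split=> /=.
    + by rewrite preimage_set0; exact: (measurable0 (s := Z)).
    + move=> E mE; rewrite setTD preimage_setC; exact: (@measurableC _ Z).
    + move=> E mE; rewrite preimage_bigcup; exact: (@bigcupT_measurable _ Z).
  move=> mA; have := measurable_fun_pair m1 m2.
  by move=> /(_ measurableT A mA); rewrite setTI.
rewrite -[X in _ -> measurable X](_ : (fun z => (f z.1, g z.2)) @^-1`
  ((fun z => (f' z.1, g' z.2)) @^-1` A) = A); last first.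
  by apply/seteqP; split=> -[x y] /=; rewrite fK gK.
move: (_ @^-1` A) => {}A.
suff : <<s @open (P * Q)%type >> `<=`
    [set E | measurable ((fun z : X * Y => (f z.1, g z.2)) @^-1` E)].
  by move=> h mA; exact: h mA.
have mF1 O : open O -> measurable (f @^-1` O).
  move=> oO; apply/mf; rewrite (imE _ _ _ _ fK f'K).
  rewrite (_ : _ @^-1` _ = O); first exact: sub_sigma_algebra.
  by apply/seteqP; split=> x /=; rewrite f'K.
have mG1 O : open O -> measurable (g @^-1` O).
  move=> oO; apply/mg; rewrite (imE _ _ _ _ gK g'K).
  rewrite (_ : _ @^-1` _ = O); first exact: sub_sigma_algebra.
  by apply/seteqP; split=> x /=; rewrite g'K.
apply: smallest_sub.
  split=> /=.
  + by rewrite preimage_set0.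
  + by move=> E mE; rewrite setTD preimage_setC; exact: measurableC.
  + by move=> E mE; rewrite preimage_bigcup; exact: bigcupT_measurable.
move=> O oO; rewrite /= (open_countable_basis (basis_prod bB bC) oO).
rewrite preimage_bigcup; apply: countable_bigcup_measurable.
  apply: sub_countable (countable_prod_basis cB cC); apply: subset_card_le.
  by move=> b [].
move=> _ [[[b c] /= [Bb Cc] <-] _].
have -> : (fun z : X * Y => (f z.1, g z.2)) @^-1` (b `*` c) = (f @^-1` b) `*` (g @^-1` c) by [].
by apply: measurableX; [apply: mF1; apply: bB.1|apply: mG1; apply: bC.1].
Qed.

(** * Walks along the remaining edges, and the splitting *)

Section Connected.
Variables (L : countType) (F : groupType) (e : L -> F) (hF : free_basis e).
Variables (T : Type) (act : F -> T -> T).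
Hypotheses (act1 : forall x, act 1%g x = x)
  (actM : forall g h x, act (g * h)%g x = act g (act h x)).
Variable keep : L -> T -> bool.
Local Notation letter := (letter e).

Lemma actK g : cancel (act g) (act g^-1%g).
Proof. by move=> x; rewrite -actM mulVg act1. Qed.
Lemma actVK g : cancel (act g^-1%g) (act g).
Proof. by move=> x; rewrite -actM mulgV act1. Qed.

(** keep s y says that the edge labelled s that ends at y may be used. *)
Definition kept_step (l : L * bool) (x : T) : bool :=
  keep l.1 (if l.2 then act (e l.1) x else x).

Fixpoint walk (w : seq (L * bool)) (x : T) : T :=
  if w is l :: w' then walk w' (act (letter l) x) else x.

Fixpoint kept_walk (w : seq (L * bool)) (x : T) : bool :=
  if w is l :: w' then kept_step l x && kept_walk w' (act (letter l) x) else true.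

Definition walk_rel : set (T * T) :=
  [set xy | exists w, kept_walk w xy.1 /\ walk w xy.1 = xy.2].

Lemma kept_step_linv l x : kept_step (linv l) (act (letter l) x) = kept_step l x.
Proof. by case: l => s [] //; rewrite /kept_step /= /letter /= actVK. Qed.

Lemma walk_cat w w' x : walk (w ++ w') x = walk w' (walk w x).
Proof. by elim: w x => [|l w IH] x //=. Qed.

Lemma kept_walk_cat w w' x :
  kept_walk (w ++ w') x = kept_walk w x && kept_walk w' (walk w x).
Proof. by elim: w x => [|l w IH] x //=; rewrite IH andbA. Qed.

Lemma walk_rel_equivalence : is_equivalence walk_rel.
Proof.
have tr x y z : walk_rel (x, y) -> walk_rel (y, z) -> walk_rel (x, z).
  move=> [w /= [wx <-]] [w' /= [w'y <-]].
  by exists (w ++ w'); rewrite /= walk_cat kept_walk_cat wx.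
split=> // [x|x y [w /= [+ <-]]]; first by exists [::].
elim: w x => [|l w IH] x /=; first by move=> _; exists [::].
move=> /andP[lx /IH h]; apply: tr h _.
by exists [:: linv l]; rewrite /= kept_step_linv lx letter_inv actK.
Qed.

Lemma walk_rel_edge s x : keep s (act (e s) x) -> walk_rel (x, act (e s) x).
Proof. by move=> h; exists [:: (s, true)]; rewrite /= /kept_step /= h. Qed.

Lemma walk_rel_orbit x y : walk_rel (x, y) -> exists g, act g x = y.
Proof.
move=> [w /= [_ <-]] {y}; elim: w x => [|l w IH] x /=; first by exists 1%g.
by have [g <-] := IH (act (letter l) x); exists (g * letter l)%g; rewrite actM.
Qed.

(** This transfers invariance from the free group to an orbit with trivial
    stabilizer, the orbit of x. *)
Lemma walk_rel_constant (chi : F -> bool) x :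
  (forall g h, act g x = act h x -> g = h) ->
  (forall s g, keep s (act (e s * g)%g x) -> chi (e s * g)%g = chi g) ->
  forall g h, walk_rel (act g x, act h x) -> chi g = chi h.
Proof.
move=> inj chiE g h [w /= [kw E]].
elim: w g kw E => [|l w IH] g /=; first by move=> _ /inj ->.
rewrite -actM => /andP[kl /IH h'] /h' <-.
move: kl; case: l {h'} => s [] /=; rewrite /kept_step /letter /=.
  by rewrite -actM => /chiE ->.
by move=> ks; rewrite -[in LHS](mulVKg (e s) g) chiE // mulVKg.
Qed.

End Connected.

Section ConnectedMeasurable.
Variables (L : countType) (F : groupType) (e : L -> F).
Variables (d : measure_display) (T : measurableType d) (act : F -> T -> T).
Variable keep : L -> T -> bool.
Hypotheses (mdiag : measurable [set z : T * T | z.1 = z.2])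
  (mact : forall g, measurable_fun setT (act g))
  (mkeep : forall s, measurable_fun setT (keep s)).

Lemma measurable_walk w : measurable_fun setT (walk e act w).
Proof.
elim: w => [|l w IH] /=; first exact: measurable_id.
exact: measurableT_comp IH (mact _).
Qed.

Lemma measurable_kept_walk w : measurable_fun setT (kept_walk e act keep w).
Proof.
elim: w => [|l w IH] /=; first exact: measurable_cst.
apply: measurable_and; last exact: measurableT_comp IH (mact _).
rewrite /kept_step; case: l.2; last exact: mkeep.
exact: measurableT_comp (mkeep _) (mact _).
Qed.

(** For each of the countably many words, the pairs that it connects form the
    graph of a measurable map above a measurable set. *)
Lemma measurable_walk_rel : measurable (walk_rel e act keep).
Proof.
have -> : walk_rel e act keep = \bigcup_w (
   (fun xy : T * T => kept_walk e act keep w xy.1) @^-1` [set true]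
   `&` (fun xy => (walk e act w xy.1, xy.2)) @^-1` [set z : T * T | z.1 = z.2]).
  by apply/seteqP; split=> xy [w]; [move=> [? ?]; exists w|move=> _ [? ?]; exists w].
apply: countable_bigcupT_measurable => [|w]; first exact: countableP.
apply: measurableI.
  rewrite -[X in measurable X]setTI.
  by apply: (measurableT_comp (measurable_kept_walk w) measurable_fst).
rewrite -[X in measurable X]setTI.
have mw := measurableT_comp (measurable_walk w) (@measurable_fst _ _ T T).
exact: (measurable_fun_pair mw measurable_snd).
Qed.

End ConnectedMeasurable.

Section Splitting.
Variables (R : realType) (L : countType) (F : groupType) (e : L -> F) (hF : free_basis e).
Variables (d : measure_display) (X : measurableType d) (mu : probability X R).
Variable (act : F -> X -> X).
Hypotheses (act1 : forall x, act 1%g x = x)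
  (actM : forall g h x, act (g * h)%g x = act g (act h x))
  (act_free : essentially_free mu act).
Variables (al be : L) (al_be : al != be) (k' : F).
Hypothesis k'P : generated_by [set e s | s in [set s | s != al /\ s != be]] k'.
Notation a := (e al).
Notation b := (e be).
Notation kappa := (k' * [~ a, b])%g.
Variables (A : X -> bool) (H : X -> nat).
Hypotheses (HA : forall z, A z -> H (act a z) = (H z).+1)
           (HN : forall z, ~~ A z -> H (act b^-1%g z) = (H z).+1).

Definition keep_edge (s : L) (y : X) : bool :=
  ~~ ((s == be) && A y || (s == al) && ~~ A (act b y)).

Notation C := (orbit_relation act (cyclic_subgroup kappa)).
Notation S := (walk_rel e act keep_edge).
Notation E := (orbit_relation act [set: F]).

Let E_equivalence : is_equivalence E.
Proof.
split=> [x|x y [g _ /= <-]|x y z [g _ /= <-] [h _ /= <-]].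
- by exists 1%g.
- by exists g^-1%g => //=; rewrite actK.
- by exists (h * g)%g => //=; rewrite actM.
Qed.

Section Generation.
Variable Q : set (X * X).
Hypotheses (Qeq : is_equivalence Q) (CQ : C `<=` Q) (SQ : S `<=` Q).

Let Qr x : Q (x, x). Proof. by case: Qeq. Qed.
Let Qs x y : Q (x, y) -> Q (y, x). Proof. by case: Qeq => _ + _; apply. Qed.
Let Qt y x z : Q (x, y) -> Q (y, z) -> Q (x, z).
Proof. by case: Qeq => _ _ +; apply. Qed.

Let Qedge s x : keep_edge s (act (e s) x) -> Q (x, act (e s) x).
Proof. by move=> h; apply: SQ; exact: walk_rel_edge. Qed.

Let Qk' x : Q (x, act k' x).
Proof.
suff : [set g | forall x, Q (x, act g x)] k' by apply.
apply: k'P => [|_ [s [sal sbe] <-] y /=].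
  split=> [y|g h gP hP y] /=; first by rewrite act1.
  rewrite actM; apply: Qt (gP _); apply: Qs.
  by rewrite -{2}(actVK act1 actM h y); exact: hP.
by apply: Qedge; rewrite /keep_edge (negbTE sal) (negbTE sbe).
Qed.

(** The conclusion joins the two ends of the deleted edge of P(z).  The only
    other edges of P(z) that can be deleted are those of P(t1) and P(t2), where
    t1 and t2 are the possible preimages of z under T. *)
Let Qpolygon n z : (H z < n)%N ->
  if A z then Q (act b^-1%g z, z)
  else Q (act a^-1%g (act b^-1%g z), act b^-1%g z).
Proof.
elim: n z => // n IH z; rewrite ltnS => zn.
have aK := actVK act1 actM a; have bK := actVK act1 actM b.
have aK' := actK act1 actM a; have bK' := actK act1 actM b.
have be_al : be == al = false by rewrite eq_sym (negbTE al_be).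
have bedge y : ~~ A y -> Q (act b^-1%g y, y).
  move=> nA; have := @Qedge be (act b^-1%g y); rewrite bK; apply.
  by rewrite /keep_edge eqxx be_al (negbTE nA).
have aedge y : A y -> Q (act a^-1%g (act b^-1%g y), act b^-1%g y).
  move=> Ay; have := @Qedge al (act a^-1%g (act b^-1%g y)); rewrite aK; apply.
  by rewrite /keep_edge eqxx (negbTE al_be) bK Ay.
pose t1 := act a^-1%g z; pose t2 := act b z.
have q1 : Q (act b^-1%g t1, t1).
  have [At|nA] := boolP (A t1); last exact: bedge.
  have Ht : (H t1 < n)%N by have := HA At; rewrite aK => <-.
  by have := IH t1 Ht; rewrite At.
have q2 : Q (t1, z).
  have : Q (act a^-1%g (act b^-1%g t2), act b^-1%g t2).
    have [At|nA] := boolP (A t2); first exact: aedge.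
    have Ht : (H t2 < n)%N by have := HN nA; rewrite bK' => <-.
    by have := IH t2 Ht; rewrite (negbTE nA).
  by rewrite bK'.
pose w := act a^-1%g (act b^-1%g z).
(* The edge of kappa, followed by k' backwards. *)
have q3 : Q (act b^-1%g t1, w).
  apply: (Qt (y := act k' w)); last exact/Qs/Qk'.
  apply: CQ; exists kappa; first by exists 1%N; left; rewrite expg1.
  by rewrite /= /w /t1 commgEl conjgE !actM bK aK.
have q : Q (w, z) by apply: Qt (Qs q3) (Qt q1 q2).
case: ifPn => Az.
  by apply: Qt q; apply: Qs; exact: aedge.
by apply: Qt q _; apply: Qs; exact: bedge.
Qed.

Lemma generated_all : E `<=` Q.
Proof.
move=> [x y] [g _ /= <-] {y}.
have Qe s z : Q (z, act (e s) z).
  have [/Qedge //|] := boolP (keep_edge s (act (e s) z)).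
  rewrite negbK => /orP[/andP[/eqP -> Az]|/andP[/eqP -> nA]].
    by have := Qpolygon (ltnSn (H (act b z))); rewrite Az actK.
  have := Qpolygon (ltnSn (H (act b (act a z)))).
  by rewrite (negbTE nA) !actK.
apply: (@free_ind _ _ _ hF (fun g => forall x, Q (x, act g x))) => {g x} [x|s g IH x|s g IH x].
- by rewrite act1.
- by rewrite actM; apply: Qt (IH x) (Qe _ _).
rewrite actM; apply: Qt (IH x) (Qs _).
by rewrite -{2}(actVK act1 actM (e s) (act g x)); exact: Qe.
Qed.

End Generation.

(** Almost every orbit is a copy of F, on which the cut functions are
    available; the equality of relations holds at every point, since depth is
    defined everywhere. *)
Lemma free_splitting : is_free_product mu E C S.
Proof.
have CE : C `<=` E by move=> xy [g _ gx]; exists g.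
have SE : S `<=` E.
  by move=> [x y] /(walk_rel_orbit act1 actM)[g gx]; exists g.
split.
  apply/seteqP; split.
    by move=> xy Exy Q /= [Qeq CSQ]; apply: (generated_all Qeq) Exy => z ?;
      apply: CSQ; [left|right].
  by apply: smallest_sub => // xy [/CE|/SE].
move=> k k0; move: act_free; apply: filterS => x xfree u u0 uc.
have inj g h : act g x = act h x -> g = h.
  move=> gh; have [//|gh'] := pselect ((h^-1 * g)%g = 1%g).
    by move=> E0; rewrite -(mulVKg h g) E0 mulg1.
  by have [] := xfree _ gh'; rewrite actM gh actK.
(* Unroll the cycle into a periodic sequence. *)
pose v' (n : nat) := u n%:R%R.
have st n : if odd n then C (v' n, v' n.+1) else S (v' n, v' n.+1).
  have [h1 h2] := uc (uphalf n)%:R%R.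
  move: h1 h2; rewrite /v' -!mulrnA muln2.
  case: ifPn => on h1 h2.
    by move: h1; rewrite uphalfE (_ : n.+1./2.*2 = n.+1) -?natr1 ?addrK //; lia.
  by move: h2; rewrite (_ : (uphalf n).*2 = n) -?natr1 //; lia.
have orb n : exists g, act g x = v' n.
  elim: n => [|n [g gx]]; first by exists 1%g; rewrite act1 /v' u0.
  have : E (v' n, v' n.+1) by have := st n; case: odd => [/CE|/SE].
  by move=> [h _ /= <-]; exists (h * g)%g; rewrite actM gx.
have [v vE] := choice orb.
pose RC g h := C (act g x, act h x); pose RS g h := S (act g x, act h x).
have [||||n vn] := @cut_cycle F RC RS _ v (2 * k).
- move=> x0.
  have [||chi [chi1 chi2]] := @cut_function L F e hF al be al_be k' k'P
    (fun g => A (act g x)) (fun g => H (act g x)) _ _ x0.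
  + by move=> z /HA; rewrite actM.
  + by move=> z /HN; rewrite actM.
  exists chi; split=> g h.
    apply: (walk_rel_constant actM inj) => s g' ks; apply: chi1.
    by move: ks; rewrite /keep_edge /removed_edge !actM.
  have it n g' : chi (kappa ^+ n * g')%g (+) ((kappa ^+ n * g')%g == x0) = chi g' (+) (g' == x0).
    elim: n => [|n IH]; first by rewrite expg0 mul1g.
    by rewrite expgS -mulgA chi2.
  move=> [c [n [->|->]] /=]; rewrite -actM => /inj <-.
    by rewrite it.
  by rewrite -(it n (kappa ^- n * g)%g) mulVKg.
- by lia.
- apply: inj; rewrite !vE /v' pchar_Zp //; lia.
- by move=> n; have := st n; rewrite /RC /RS !vE.
by exists n%:R%R; rewrite natr1 -/(v' n) -/(v' n.+1) -!vE vn.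
Qed.

End Splitting.

(** * The action *)

Lemma act_mpreserving (L : Type) (F : groupType) (e : L -> F) (hF : free_basis e)
    (R : realType) d (T : measurableType d) (mu : set T -> \bar R)
    (h : L -> sym T) (act : F -> T -> T) :
  (forall x, act 1%g x = x) -> (forall g g' x, act (g * g')%g x = act g (act g' x)) ->
  (forall s x, act (e s) x = h s x) ->
  (forall s, mpreserving mu (h s)) -> (forall s, mpreserving mu (sinv (h s))) ->
  forall g, mpreserving mu (act g).
Proof.
move=> act1 actM actE ph pV.
have pe s : mpreserving mu (act (e s)).
  by rewrite (_ : act (e s) = h s) //; apply/funext => x; rewrite actE.
have pVe s : mpreserving mu (act (e s)^-1%g).
  rewrite (_ : act _ = sinv (h s)) //; apply/funext => x.
  by rewrite -{1}(sinvK (h s) x) -actE (actK act1 actM).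
apply: (free_ind hF) => [|s g IH|s g IH].
- rewrite (_ : act 1%g = id); first by split => // A mA; exact: measurable_id.
  by apply/funext => x; rewrite act1.
- rewrite (_ : act _ = act (e s) \o act g); first exact: mpreserving_comp.
  by apply/funext => x; rewrite actM.
rewrite (_ : act _ = act (e s)^-1%g \o act g); first exact: mpreserving_comp.
by apply/funext => x; rewrite actM.
Qed.

Section Sides.
Context {R : realType}.
Notation I := (measurableTypeR R).
Notation unit_mu := (@unit_measure R).

Lemma sideK : cancel (unfold_map \o cshift (- 2^-1)) (cshift 2^-1 \o @fold_map R).
Proof. by move=> x /=; rewrite unfold_mapK cshiftNK. Qed.
Lemma sideVK : cancel (cshift 2^-1 \o @fold_map R) (unfold_map \o cshift (- 2^-1)).
Proof. by move=> x /=; rewrite cshiftK fold_mapK. Qed.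

Definition fold_sym : sym I := Sym (@fold_mapK R) (@unfold_mapK R).
(** The action of b.  Its inverse is the other branch of T, the folding map
    followed by the rotation by 1/2. *)
Definition side_sym : sym I := Sym sideK sideVK.
Definition parabolic_sym (k : int) : sym (I * I) :=
  Sym (@parabolicK R k 3) (@parabolicVK R k 3).

Lemma fold_mpreserving : mpreserving unit_mu fold_map.
Proof. by split; [exact: measurable_fold_map|exact: fold_map_preserves]. Qed.
Lemma unfold_mpreserving : mpreserving unit_mu unfold_map.
Proof. by split; [exact: measurable_unfold_map|exact: unfold_map_preserves]. Qed.

Lemma measurable_diagonal :
  measurable [set z : (I * (I * I)) * (I * (I * I)) | z.1 = z.2].
Proof.
have meq (f g : (I * (I * I)) * (I * (I * I)) -> R) : measurable_fun setT f ->
    measurable_fun setT g -> measurable [set z | f z = g z].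
  move=> mf mg; have := measurable_fun_eqr mf mg measurableT (Y := [set true]) Logic.I.
  by rewrite setTI; congr measurable; apply/seteqP; split=> z /= /eqP.
have f1 := @measurable_fst _ _ (I * (I * I))%type (I * (I * I))%type.
have f2 := @measurable_snd _ _ (I * (I * I))%type (I * (I * I))%type.
have g1 := @measurable_fst _ _ I (I * I)%type.
have g2 := @measurable_snd _ _ I (I * I)%type.
have h1 := @measurable_fst _ _ I I.
have h2 := @measurable_snd _ _ I I.
have := measurableI _ _ (meq _ _ (measurableT_comp g1 f1) (measurableT_comp g1 f2))
  (measurableI _ _ (meq _ _ (measurableT_comp h1 (measurableT_comp g2 f1))
     (measurableT_comp h1 (measurableT_comp g2 f2)))
   (meq _ _ (measurableT_comp h2 (measurableT_comp g2 f1))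
     (measurableT_comp h2 (measurableT_comp g2 f2)))).
congr measurable; apply/seteqP; split=> -[[x [y z]] [x' [y' z']]] /=.
  by move=> [-> [-> ->]].
by move=> [-> -> ->].
Qed.

End Sides.

Lemma cyclic_is_subgroup (G : groupType) (x : G) : is_subgroup (cyclic_subgroup x).
Proof.
split; first by exists 0%N; left; rewrite expg0.
move=> _ _ [m [->|->]] [n [->|->]].
- have [nm|mn] := leqP n m.
    by exists (m - n)%N; left; rewrite expgnFr.
  exists (n - m)%N; right; rewrite expgnFr; last exact: ltnW.
  by rewrite invgF.
- by exists (m + n)%N; left; rewrite invgK expgnDr.
- by exists (n + m)%N; right; rewrite expgnDr invgM.
- rewrite invgK; have [nm|mn] := leqP n m.
    by exists (m - n)%N; right; rewrite -{1}(subnKC nm) expgnDr invgM mulgVK.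
  by exists (n - m)%N; left; rewrite -{1}(subnKC (ltnW mn)) expgnDr mulKg.
Qed.

Lemma negligible_snd (R : realType) d1 d2 (T1 : measurableType d1) (T2 : measurableType d2)
    (P1 : probability T1 R) (P2 : probability T2 R) (N : set T2) :
  P2.-negligible N -> ((P1 \x P2)%E).-negligible (snd @^-1` N).
Proof.
move=> [B [mB B0 NB]]; exists (setT `*` B); split.
- exact: measurableX.
- by apply: etrans (product_measure1E P1 P2 measurableT mB) _; rewrite [X in (_ * X)%E]B0 mule0.
- by move=> z /= /NB.
Qed.

Theorem theorem3p2 (R : realType) (p : nat) (hp : (1 <= p)%N)
    (F : groupType) (a b : 'I_p -> F)
    (hF : free_basis (sum_family a b)) :
  measure_free_factor R (cyclic_subgroup (prod_commutators a b)).
Proof.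
case: p hp a b hF => // p _ a b hF.
set e := sum_family a b in hF *.
pose al : 'I_p.+1 + 'I_p.+1 := inl ord_max.
pose be : 'I_p.+1 + 'I_p.+1 := inr ord_max.
(* The commutators before the last one only involve other generators. *)
pose k' : F := (\prod_(i < p) [~ a (widen_ord (leqnSn p) i), b (widen_ord (leqnSn p) i)])%g.
have kappaE : prod_commutators a b = (k' * [~ e al, e be])%g.
  by rewrite /prod_commutators big_ord_recr.
have k'P : generated_by [set e s | s in [set s | s != al /\ s != be]] k'.
  move=> W [W1 WV] eW.
  have WVV x : W x -> W x^-1%g by move=> Wx; rewrite -[_^-1%g]mul1g; apply: WV.
  have WM x y : W x -> W y -> W (x * y)%g.
    by move=> Wx Wy; rewrite -[y]invgK; apply: WV => //; exact: WVV.
  apply: (big_ind W) => // i _.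
  have wi : widen_ord (leqnSn p) i != ord_max.
    by rewrite neq_ltn /= ltn_ord.
  have Wa : W (a (widen_ord (leqnSn p) i)) by apply: eW; exists (inl (widen_ord (leqnSn p) i)).
  have Wb : W (b (widen_ord (leqnSn p) i)) by apply: eW; exists (inr (widen_ord (leqnSn p) i)).
  by rewrite commgEl conjgE; apply: (WM _ _ (WVV _ Wa)); apply: (WM _ _ (WVV _ Wb)); apply: WM.
have al_be : al != be by [].
split.
  exact: cyclic_is_subgroup.
(* First factor: only the last pair of generators acts. *)
pose hy (s : 'I_p.+1 + 'I_p.+1) : sym (measurableTypeR R) :=
  if s == al then fold_sym else if s == be then side_sym else 1%g.
(* Second factor: the fixed directions only have to be distinct. *)
pose kz (s : 'I_p.+1 + 'I_p.+1) : int :=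
  match s with inl i => Posz i | inr i => Posz (i + p.+1) end.
have kz_inj : injective kz.
  by move=> [[i il]|[i il]] [[j jl]|[j jl]] /= E; try congr inl; try congr inr;
   try apply: val_inj => /=; lia.
have [ay [ay1 ayM ayE]] := free_act hF hy.
have [az [az1 azM azE]] := free_act hF (fun s => @parabolic_sym R (kz s)).
pose mu1 := @unit_measure R.
pose act g (x : measurableTypeR R * (measurableTypeR R * measurableTypeR R)) :=
  (ay g x.1, az g x.2).
have act1 x : act 1%g x = x by case: x => x z; rewrite /act ay1 az1.
have actM g h x : act (g * h)%g x = act g (act h x) by rewrite /act ayM azM.
have py g : mpreserving mu1 (ay g).
  have pid : mpreserving mu1 id by split => // ? ?; exact: measurable_id.
  apply: (act_mpreserving hF ay1 ayM ayE) => s; rewrite /hy.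
    case: ifP => _; first exact: fold_mpreserving.
    case: ifP => _ //; apply: mpreserving_comp unfold_mpreserving (cshift_mpreserving _).
  case: ifP => _; first exact: unfold_mpreserving.
  case: ifP => _ //; apply: mpreserving_comp (cshift_mpreserving _) fold_mpreserving.
have pz g : mpreserving (mu1 \x mu1)%E (az g).
  by apply: (act_mpreserving hF az1 azM azE) => s; exact: parabolic_mpreserving.
pose mu : probability _ R := (mu1 \x (mu1 \x mu1))%E.
have pact g : mpreserving mu (act g) by apply: mpreserving_prod.
have act_free : essentially_free mu act.
  apply: negligibleS (negligible_snd mu1 rational_lines_negligible) => x /=.
  move=> /existsNP[g /not_implyP[g1 /contrapT gx]].
  have [r [s [r0 /(_ x.2)]]] := fixed_point_line hF kz_inj az1 azM azE g1.
  have -> : az g x.2 = x.2 by rewrite -[in RHS]gx.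
  by move=> /(_ erefl) /intrP[n E]; exists r, s, n.
exists _, (measurableTypeR R * (measurableTypeR R * measurableTypeR R))%type, mu, act.
pose A (x : measurableTypeR R * (measurableTypeR R * measurableTypeR R)) := low x.1.
pose H (x : measurableTypeR R * (measurableTypeR R * measurableTypeR R)) := depth x.1.
split.
- apply: standard_borel_prod; first exact: standard_borel_real.
  by apply: standard_borel_prod; exact: standard_borel_real.
- split; [exact: act1|exact: actM| |] => g; by case: (pact g).
- exact: act_free.
exists (walk_rel e act (keep_edge e act al be A)); split.
  split.
  - apply: measurable_walk_rel => [|g|s].
    + exact: measurable_diagonal.
    + by case: (pact g).
    have mA : measurable_fun setT A by exact: measurableT_comp measurable_low measurable_fst.
    rewrite /keep_edge; apply: measurable_neg; apply: measurable_or;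
      apply: measurable_and => //; apply: measurable_neg.
    by apply: measurableT_comp mA _; case: (pact (e be)).
  - exact: walk_rel_equivalence.
  - by move=> [x y] /(walk_rel_orbit act1 actM)[g gx]; exists g.
rewrite kappaE; apply: (free_splitting hF act1 actM act_free al_be k'P (H := H)).
- move=> z lz; rewrite /H.
  have -> : (act (e al) z).1 = fold_map z.1.
    by rewrite -[LHS]/(ay (e al) z.1) ayE /hy eqxx.
  exact: depth_low.
move=> z lz; rewrite /H -[X in depth X]/(ay (e be)^-1%g z.1).
have -> : ay (e be)^-1%g z.1 = cshift 2^-1 (fold_map z.1).
  have -> : z.1 = ay (e be) (cshift 2^-1 (fold_map z.1)).
    by rewrite ayE /hy /= eqxx (sinvK side_sym).
  by rewrite (actK ay1 ayM) ayE /hy /= eqxx (sinvK side_sym).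
exact: depth_high.
Qed.
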